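(* Let $U$ be an optimal prefix-free machine and let $f:2^\omega\to[0,1]$, $f(x)=\sum_{\sigma\le_L x}2^{-K_U(\sigma)}$. For any real $x\in 2^\omega$, $x$ is weakly low for $K$ if and only if $f(x)$ is $x$-random.
   Context: A machine is a partial computable function $M$ from $2^{<\omega}$ to $2^{<\omega}$; it is prefix-free if its domain is a prefix-free set. $K_M(\sigma)=\min\{|\tau|: M(\tau)=\sigma\}$ ($=\infty$ if there is no such $\tau$, with $2^{-\infty}=0$). A prefix-free machine $U$ is optimal if for each prefix-free machine $M$ there is a constant $c$ with $K_U(\sigma)\le K_M(\sigma)+c$ for all $\sigma$. $K=K_U$ is prefix-free complexity, and $K^x$ is prefix-free complexity relative to the oracle $x$; natural numbers are identified with strings via a computable bijection. For $\sigma\in 2^{<\omega}$ and $x\in 2^\omega$, $\sigma<_L x$ means that there is $n$ with $\sigma\upharpoonright n=x\upharpoonright n$, $\sigma(n)=0$ and $x(n)=1$; $\sigma\le_L x$ means that $\sigma<_L x$ or $\sigma$ is an initial segment of $x$. A real $x$ is weakly low for $K$ if there is $c\in\omega$ such that $K(n)\le K^x(n)+c$ for infinitely many $n$. For an oracle $z$, a real $y$ is $z$-random if there is a constant $c$ with $K^z(y\upharpoonright n)\ge n-c$ for all $n$. Reals in $[0,1]$ are identified with their binary expansions. *)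

(* Defs.v *)
From HB Require Import structures.
From mathcomp Require Import all_boot all_order all_algebra.
From mathcomp Require Import all_classical all_reals ereal normedtype sequences.
From mathcomp Require Import esum.

Set Implicit Arguments.
Unset Strict Implicit.
Unset Printing Implicit Defensive.

Import Order.TTheory GRing.Theory Num.Theory.

Local Open Scope classical_set_scope.

Notation str := (seq bool).
Notation cantor := (nat -> bool).

(** ** Oracle computability: Kleene's mu-recursive functions with an oracle *)

(* [code n] is the syntax of the n-ary functions; [Comp] takes its inner
   functions as a family indexed by ['I_m]. *)
Inductive code : nat -> Type :=
| Zero n : code n
| Succ : code 1
| Proj n (i : 'I_n) : code n
| Oracle : code 1
| Comp m n (f : code m) (gs : 'I_m -> code n) : code n
| Prec n (f : code n) (g : code n.+2) : code n.+1
| Mu n (f : code n.+1) : code n.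

(* [eval x c v y]: with oracle [x], the partial function denoted by [c] is
   defined at [v] and takes the value [y] there.  In [Mu], all the values
   before the first zero have to be defined. *)
Fixpoint eval (x : cantor) (n : nat) (c : code n) : n.-tuple nat -> nat -> Prop :=
  match c in code n return n.-tuple nat -> nat -> Prop with
  | Zero _ => fun _ y => y = 0
  | Succ => fun v y => y = (thead v).+1
  | Proj _ i => fun v y => y = tnth v i
  | Oracle => fun v y => y = x (thead v)
  | Comp m _ f gs => fun v y =>
      exists w : m.-tuple nat,
        (forall i, eval x (gs i) v (tnth w i)) /\ eval x f w y
  | Prec _ f g => fun v =>
      (fix rec (k : nat) (y : nat) : Prop :=
         match k with
         | 0 => eval x f [tuple of behead v] y
         | k'.+1 => exists z, rec k' z /\
             eval x g [tuple of k' :: z :: [tuple of behead v]] y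
         end) (thead v)
  | Mu _ f => fun v y =>
      eval x f [tuple of y :: v] 0 /\
      forall k, k < y -> exists z, eval x f [tuple of k :: v] z.+1
  end.

(** ** Identification of strings with natural numbers *)

(* Bijective base 2, with the first bit of the string least significant. *)
Fixpoint nat_of_str (s : str) : nat :=
  if s is b :: s' then (nat_of_str s').*2 + b.+1 else 0.

Fixpoint next_str (s : str) : str :=
  match s with
  | [::] => [:: false]
  | false :: s' => true :: s'
  | true :: s' => false :: next_str s'
  end.

Definition str_of_nat (n : nat) : str := iter n next_str [::].

Lemma nat_of_next_str s : nat_of_str (next_str s) = (nat_of_str s).+1.
Proof.
elim: s => [|[] s IHs] //=; last by rewrite !addnS.
by rewrite IHs doubleS addn1 addn2.
Qed.

Lemma str_of_natK : cancel str_of_nat nat_of_str.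
Proof. by elim=> [|n IHn] //=; rewrite nat_of_next_str IHn. Qed.

Lemma nat_of_str_inj : injective nat_of_str.
Proof.
elim=> [|b s IHs] [|c t] //=; rewrite ?addnS // => -[] e.
have eb : b = c.
  by have := congr1 odd e; rewrite !oddD !odd_double; case: b c {e} => [] [].
by move: e; rewrite eb => /addIn/double_inj/IHs->.
Qed.

Lemma nat_of_strK : cancel nat_of_str str_of_nat.
Proof. by move=> s; apply: nat_of_str_inj; rewrite str_of_natK. Qed.

(** ** Machines and prefix-free complexity *)

(* A partial function on strings; [None] means undefined. *)
Definition pfun_str := str -> option str.

Definition computable_in (x : cantor) (M : pfun_str) : Prop :=
  exists c : code 1, forall s t,
    M s = Some t <-> eval x c [tuple nat_of_str s] (nat_of_str t).

Definition prefix_free (A : set str) : Prop :=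
  forall s t, A s -> A t -> prefix s t -> s = t.

Definition prefix_free_machine_in (x : cantor) (M : pfun_str) : Prop :=
  computable_in x M /\ prefix_free [set s | M s <> None].

Definition has_program (M : pfun_str) (s : str) : pred nat :=
  fun k => `[< exists t, M t = Some s /\ size t = k >].

(* K_M(s), a natural number or +oo; the type [\bar int] provides the order and
   the arithmetic. *)
Definition K (M : pfun_str) (s : str) : \bar int :=
  if pselect (exists k, has_program M s k) is left ex
  then (ex_minn ex)%:Z%:E else +oo%E.

Definition optimal_in (x : cantor) (U : pfun_str) : Prop :=
  prefix_free_machine_in x U /\
  forall M, prefix_free_machine_in x M ->
    exists c : nat, forall s, (K U s <= K M s + c%:Z%:E)%E.

(* Plain computability is computability in the empty oracle. *)
Definition optimal (U : pfun_str) : Prop := optimal_in (fun=> false) U.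

(* In the next two definitions [V] stands for an optimal prefix-free machine
   relative to the oracle, so that [K V] is the relativized complexity. *)
Definition weakly_low_for_K (U V : pfun_str) : Prop :=
  exists c : nat,
    infinite_set
      [set n | (K U (str_of_nat n) <= K V (str_of_nat n) + c%:Z%:E)%E].

Definition random_for (V : pfun_str) (y : cantor) : Prop :=
  exists c : nat, forall n, ((n%:Z - c%:Z)%:E <= K V (mkseq y n))%E.

(** ** The function f *)

Definition ltL (s : str) (x : cantor) : Prop :=
  exists n, [/\ n < size s, take n s = mkseq x n,
                nth false s n = false & x n = true].

Definition leL (s : str) (x : cantor) : Prop :=
  ltL s x \/ s = mkseq x (size s).

Section Reals.
Variable R : realType.
Local Open Scope ring_scope.

Definition pow2N (k : \bar int) : R := if k is n%:E then 2 ^ (- n) else 0.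

(* By Kraft's inequality the values lie in [0, 1]. *)
Definition fK (U : pfun_str) (x : cantor) : \bar R :=
  \esum_(s in [set s | leL s x]) (pow2N (K U s))%:E.

Definition binary_expansion (y : cantor) (r : \bar R) : Prop :=
  r = (\sum_(0 <= i <oo) ((y i)%:R / 2 ^+ i.+1 : R)%:E)%E.

(* A dyadic rational has two expansions, neither of which is random. *)
Definition random_real_for (V : pfun_str) (r : \bar R) : Prop :=
  exists y, binary_expansion y r /\ random_for V y.

End Reals.

(* Main.v *)
From mathcomp Require Import all_boot all_order all_algebra.
From mathcomp Require Import all_classical all_reals ereal normedtype sequences esum.
From mathcomp Require Import zify lra.
Require Import Defs.

(** Write [alpha] for [fK R U x].  As [2^-n] is the sum of the [2^-k] with [k > n],
    [alpha] is the sum of [2^-k] over the pairs [(k, s)] with [leL s x] such that [s]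
    has a [U]-program shorter than [k].  These pairs, called requests, can be enumerated
    without repetition relative to [x] ([requests_exist], [fK_wsum_sup]), since [leL] is
    decidable in [x].  So [alpha] is approximated from below by steps that are powers of
    two, and the Kraft-Chaitin lemma [kraft_chaitin] gives each request a program, which
    as a dyadic interval lies inside the step that the request causes.

    From weak lowness to randomness.  Let [y] be an expansion of [alpha] with
    [0.w < alpha <= 0.w + 2^-n] for all its prefixes [w] (of length [n]), and suppose
    that [y] is not random.  Let [N] be the Kraft-Chaitin machine of the requests.  All
    but finitely many of its programs lie between [0.w] and [alpha], hence extend [w].
    When [w] has a description [s] for [V] with [size s + C < n], replacing [w] by [s]
    in these programs ([relay_machine]) saves [C] bits on all but finitely many outputs.
    Each [0^n] is on the left of [x] and is as simple as [n], so [K V n] is below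
    [K U n] by more than any constant for almost all [n].

    From randomness to weak lowness.  Suppose that for each [c] almost all [n] satisfy
    [K U n > K V n + c].  A request [(k, s)] is confirmed at level [c] once a program of
    [V] for [s] of length less than [k - c] is found.  By Kraft's inequality the
    requests confirmed at level [c] weigh at most [2^-c], and only finitely many
    requests are never confirmed ([late_confirmed]).  As confirmation comes after
    enumeration, the part of [alpha] still to come is eventually at most the weight
    still to be confirmed.  So a sequence of intervals can be produced relative to [x],
    each of them starting at the end of the previous one, or at the current
    approximation of [alpha] if that is further right, and twice as long as the weight
    just confirmed; their total length is at most [2 * 2^-c], and one of them contains
    [alpha] ([cover_hits]).  Applied to all levels at once, Kraft-Chaitin turns these
    intervals into descriptions of prefixes of [y] that save arbitrarily many bits.

    That the machines used are computable is shown through their graphs.  A relation is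
    recursively enumerable in [x] if one unbounded search over a total computable
    predicate decides it positively; the graph of every code is such a relation (Kleene's
    normal form, [re_eval]), and every single-valued such relation is the graph of a
    code ([machine_of_computable]). *)

Set Implicit Arguments.
Unset Strict Implicit.
Unset Printing Implicit Defensive.

Import Order.TTheory GRing.Theory Num.Theory.

(** * Total computable functions *)

(** Arguments come as lists rather than tuples, so that bound variables can be pushed with
    [::] and dropped with [behead] without casts between arities. *)
Definition cpt (x : cantor) n (F : seq nat -> nat) :=
  exists c : code n, forall (v : n.-tuple nat) y, eval x c v y <-> y = F v.

Section Computable.
Variable x : cantor.
Implicit Types (F G : seq nat -> nat) (v : seq nat).
Local Notation cpt := (cpt x).

Lemma eq_cpt n F G : (forall v, size v = n -> F v = G v) -> cpt n F -> cpt n G.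
Proof.
move=> e [c hc]; exists c => v y.
by rewrite hc e // size_tuple.
Qed.

Lemma cpt_const n k : cpt n (fun=> k).
Proof.
elim: k => [|k [c hc]]; first by exists (Zero n) => v y.
exists (Comp Succ (fun=> c)) => v y /=; split=> [[w [hw ->]]|->].
  by move/hc: (hw ord0); rewrite (tnth_nth 0) => <-; case: w {hw} => [[|? []]].
exists [tuple k]; split=> // i; apply/hc; by rewrite (tnth_nth 0) ord1.
Qed.

Lemma cpt_nth n i : cpt n (fun v => nth 0 v i).
Proof.
have [lt_in|le_ni] := ltnP i n.
  by exists (Proj (Ordinal lt_in)) => v y /=; rewrite (tnth_nth 0).
apply: eq_cpt (cpt_const n 0) => v sv; by rewrite nth_default ?sv.
Qed.

Lemma cpt_comp m n F (Gs : nat -> seq nat -> nat) :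
  cpt m F -> (forall i, i < m -> cpt n (Gs i)) ->
  cpt n (fun v => F (mkseq (Gs^~ v) m)).
Proof.
move=> [f hf] hG.
have /choice[gs hgs] : forall i : 'I_m, exists c : code n,
    forall (v : n.-tuple nat) y, eval x c v y <-> y = Gs i v.
  by move=> i; exact: hG.
exists (Comp f gs) => v y /=; split=> [[w [hw /hf ->]]|->].
  congr F; apply: (@eq_from_nth _ 0) => [|i]; rewrite size_tuple ?size_mkseq //.
  move=> lt_im; rewrite nth_mkseq //; move/hgs: (hw (Ordinal lt_im)).
  by rewrite (tnth_nth 0) /= => ->.
exists [tuple Gs i v | i < m]; split.
  by move=> i; apply/hgs; rewrite tnth_mktuple.
apply/hf; congr F; apply: (@eq_from_nth _ 0) => [|i]; rewrite size_tuple ?size_mkseq //.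
move=> lt_im; rewrite nth_mkseq // -[i]/(nat_of_ord (Ordinal lt_im)) -(tnth_nth 0 [tuple Gs i
  v | i < m]).
by rewrite tnth_mktuple.
Qed.

Definition cpt1 (f : nat -> nat) := cpt 1 (fun v => f (nth 0 v 0)).
Definition cpt2 (f : nat -> nat -> nat) := cpt 2 (fun v => f (nth 0 v 0) (nth 0 v 1)).
Definition cpt3 (f : nat -> nat -> nat -> nat) :=
  cpt 3 (fun v => f (nth 0 v 0) (nth 0 v 1) (nth 0 v 2)).

Lemma cpt_app1 f n F : cpt1 f -> cpt n F -> cpt n (fun v => f (F v)).
Proof.
move=> hf hF; have := @cpt_comp _ n _ (nth (fun=> 0) [:: F]) hf.
by apply=> -[].
Qed.

Lemma cpt_app2 f n F G : cpt2 f -> cpt n F -> cpt n G ->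
  cpt n (fun v => f (F v) (G v)).
Proof.
move=> hf hF hG; have := @cpt_comp _ n _ (nth (fun=> 0) [:: F; G]) hf.
by apply=> -[|[]].
Qed.

Lemma cpt_app3 f n F G H : cpt3 f -> cpt n F -> cpt n G -> cpt n H ->
  cpt n (fun v => f (F v) (G v) (H v)).
Proof.
move=> hf hF hG hH; have := @cpt_comp _ n _ (nth (fun=> 0) [:: F; G; H]) hf.
by apply=> -[|[|[]]].
Qed.

Lemma cpt_nth_behead n i : cpt n (fun v => nth 0 (behead v) i).
Proof. by apply: eq_cpt (cpt_nth n i.+1) => v _; rewrite nth_behead. Qed.

Lemma cpt_nth_behead2 n i : cpt n (fun v => nth 0 (behead (behead v)) i).
Proof. by apply: eq_cpt (cpt_nth n i.+2) => v _; rewrite !nth_behead. Qed.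

Lemma cpt_nth_behead3 n i : cpt n (fun v => nth 0 (behead (behead (behead v))) i).
Proof. by apply: eq_cpt (cpt_nth n i.+3) => v _; rewrite !nth_behead. Qed.

(** The counter and the accumulator are pushed in front of the parameters, in the order
    that [Prec] uses. *)
Lemma cpt_iteri n A (G : nat -> nat -> seq nat -> nat) B :
  cpt n A -> cpt n.+2 (fun v => G (nth 0 v 0) (nth 0 v 1) (behead (behead v))) -> cpt n B ->
  cpt n (fun v => iteri (B v) (fun i z => G i z v) (A v)).
Proof.
move=> [a ha] [g hg] hB.
have hP : cpt n.+1 (fun v => iteri (head 0 v) (fun i z => G i z (behead v)) (A (behead v))).
  exists (Prec a g) => v y; rewrite /= -/(eval _).
  have ->: head 0 v = thead v by case/tupleP: v => k v.
  elim: (thead v) y => [|k IHk] y /=; first by rewrite ha.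
  split=> [[z [/IHk -> /hg ->]]|->]; first by [].
  eexists; split; first exact/IHk.
  exact/hg.
have := @cpt_comp _ n _ (fun i v => if i is j.+1 then nth 0 v j else B v) hP.
move=> /(_ _)/eq_cpt; apply=> [v sv|[|i] _]; last 2 first.
- by [].
- exact: cpt_nth.
have -> : mkseq (fun i => if i is j.+1 then nth 0 v j else B v) n.+1 = B v :: v.
  apply: (@eq_from_nth _ 0) => [|[|i]]; rewrite size_mkseq ?[size (_ :: _)]/= ?sv //.
  by move=> lt_in; rewrite nth_mkseq.
by [].
Qed.

End Computable.

Section Arith.
Variable x : cantor.
Implicit Types (F G H : seq nat -> nat) (v : seq nat).
Local Notation cpt := (cpt x).

Lemma cpt_succ n F : cpt n F -> cpt n (fun v => (F v).+1).
Proof.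
move=> hF; apply: (cpt_app1 (f := S)) hF.
by exists Succ => v y /=; case/tupleP: v.
Qed.

Lemma cpt_oracle n F : cpt n F -> cpt n (fun v => x (F v)).
Proof.
move=> hF; apply: (cpt_app1 (f := fun a => nat_of_bool (x a))) hF.
by exists Oracle => v y /=; case/tupleP: v.
Qed.

Lemma cpt_addn n F G : cpt n F -> cpt n G -> cpt n (fun v => F v + G v).
Proof.
move=> hF hG; apply: eq_cpt (@cpt_iteri x n F (fun _ z _ => z.+1) G hF _ hG).
  by move=> v _; elim: (G v) => [|k]; rewrite ?addn0 //= => ->; rewrite addnS.
by apply: cpt_succ; exact: cpt_nth.
Qed.

Lemma cpt_pred n F : cpt n F -> cpt n (fun v => (F v).-1).
Proof.
move=> hF; apply: eq_cpt (@cpt_iteri x n (fun=> 0) (fun i _ _ => i) F _ _ hF).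
- by move=> v _; case: (F v).
- exact: cpt_const.
- exact: cpt_nth.
Qed.

Lemma cpt_subn n F G : cpt n F -> cpt n G -> cpt n (fun v => F v - G v).
Proof.
move=> hF hG; apply: eq_cpt (@cpt_iteri x n F (fun _ z _ => z.-1) G hF _ hG).
  by move=> v _; elim: (G v) => [|k]; rewrite ?subn0 //= => ->; rewrite subnS.
by apply: cpt_pred; exact: cpt_nth.
Qed.

Lemma cpt_muln n F G : cpt n F -> cpt n G -> cpt n (fun v => F v * G v).
Proof.
move=> hF hG; have h2 : cpt2 x muln.
  apply: eq_cpt (@cpt_iteri x 2 (fun=> 0) (fun _ z v => z + nth 0 v 0) (fun v => nth 0 v 1) _
    _ _).
  - by move=> v _; elim: (nth 0 v 1) => [|k]; rewrite ?muln0 //= => ->; rewrite mulnS addnC.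
  - exact: cpt_const.
  - by apply: cpt_addn; [exact: cpt_nth|exact: cpt_nth_behead2].
  - exact: cpt_nth.
exact: cpt_app2 h2 hF hG.
Qed.

Lemma cpt_expn n F G : cpt n F -> cpt n G -> cpt n (fun v => F v ^ G v).
Proof.
move=> hF hG; have h2 : cpt2 x expn.
  apply: eq_cpt (@cpt_iteri x 2 (fun=> 1) (fun _ z v => z * nth 0 v 0) (fun v => nth 0 v 1) _
    _ _).
  - by move=> v _; elim: (nth 0 v 1) => [|k]; rewrite ?expn0 //= => ->; rewrite expnS mulnC.
  - exact: cpt_const.
  - by apply: cpt_muln; [exact: cpt_nth|exact: cpt_nth_behead2].
  - exact: cpt_nth.
exact: cpt_app2 h2 hF hG.
Qed.

Lemma cpt_neg n (P : seq nat -> bool) : cpt n P -> cpt n (fun v => ~~ P v).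
Proof.
move=> hP; apply: eq_cpt (cpt_subn (cpt_const x n 1) hP) => v _.
by case: (P v).
Qed.

Lemma cpt_and n (P Q : seq nat -> bool) : cpt n P -> cpt n Q -> cpt n (fun v => P v && Q v).
Proof.
move=> hP hQ; apply: eq_cpt (cpt_muln hP hQ) => v _.
by case: (P v); case: (Q v).
Qed.

Lemma cpt_or n (P Q : seq nat -> bool) : cpt n P -> cpt n Q -> cpt n (fun v => P v || Q v).
Proof.
move=> hP hQ; apply: eq_cpt (cpt_neg (cpt_and (cpt_neg hP) (cpt_neg hQ))) => v _.
by case: (P v); case: (Q v).
Qed.

Lemma cpt_leq n F G : cpt n F -> cpt n G -> cpt n (fun v => F v <= G v).
Proof.
move=> hF hG; apply: eq_cpt (cpt_subn (cpt_const x n 1) (cpt_subn hF hG)) => v _.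
by rewrite /leq; case: (F v - G v).
Qed.

Lemma cpt_eq n F G : cpt n F -> cpt n G -> cpt n (fun v => F v == G v).
Proof.
move=> hF hG; apply: eq_cpt (cpt_and (cpt_leq hF hG) (cpt_leq hG hF)) => v _.
by rewrite -eqn_leq.
Qed.

Lemma cpt_if n (P : seq nat -> bool) F G : cpt n P -> cpt n F -> cpt n G ->
  cpt n (fun v => if P v then F v else G v).
Proof.
move=> hP hF hG.
apply: eq_cpt (cpt_addn (cpt_muln hP hF) (cpt_muln (cpt_neg hP) hG)) => v _.
by case: (P v); rewrite ?mul1n ?mul0n ?addn0.
Qed.

Lemma cpt_sum n (F : nat -> seq nat -> nat) B :
  cpt n.+1 (fun v => F (nth 0 v 0) (behead v)) -> cpt n B ->
  cpt n (fun v => \sum_(i < B v) F i v).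
Proof.
move=> hF hB.
apply: eq_cpt (@cpt_iteri x n (fun=> 0) (fun i z v => z + F i v) B _ _ hB).
- move=> v _; elim: (B v) => [|k]; rewrite ?big_ord0 //= => ->.
  by rewrite big_ord_recr.
- exact: cpt_const.
apply: cpt_addn; first exact: cpt_nth.
have := @cpt_comp x _ n.+2 _ (fun i v => nth 0 v (if i is j.+1 then j.+2 else 0)) hF.
move=> /(_ (fun i _ => cpt_nth x _ _)); apply: eq_cpt => v sv.
rewrite nth_mkseq //; congr F; apply: (@eq_from_nth _ 0).
  by rewrite !size_behead size_mkseq sv.
move=> i; rewrite size_behead size_mkseq => lt_in.
by rewrite !nth_behead nth_mkseq // ltnS; lia.
Qed.

Definition has_below (P : nat -> bool) B := has P (iota 0 B).
Definition all_below (P : nat -> bool) B := all P (iota 0 B).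

Lemma has_belowP (P : pred nat) B : reflect (exists2 i, i < B & P i) (has_below P B).
Proof.
apply: (iffP hasP) => -[i].
  by rewrite mem_iota; exists i.
by move=> ? ?; exists i; rewrite // mem_iota.
Qed.

Lemma all_belowP (P : pred nat) B : reflect (forall i, i < B -> P i) (all_below P B).
Proof.
apply: (iffP allP) => h i.
  by move=> ?; apply: h; rewrite mem_iota.
by rewrite mem_iota => ?; apply: h.
Qed.

Lemma cpt_has_below n (P : nat -> seq nat -> bool) B :
  cpt n.+1 (fun v => P (nth 0 v 0) (behead v)) -> cpt n B ->
  cpt n (fun v => has_below (P^~ v) (B v)).
Proof.
move=> hP hB; have hs := cpt_leq (cpt_const x n 1) (@cpt_sum n (fun i v => P i v) B hP hB).
apply: eq_cpt hs => v _; congr nat_of_bool; rewrite lt0n sum_nat_eq0.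
apply/idP/has_belowP => [/forall_inPn[i _]|[i lt_i Pi]].
  by rewrite eqb0 negbK => Pi; exists i.
by apply/forall_inPn; exists (Ordinal lt_i); rewrite //= Pi.
Qed.

Lemma cpt_all_below n (P : nat -> seq nat -> bool) B :
  cpt n.+1 (fun v => P (nth 0 v 0) (behead v)) -> cpt n B ->
  cpt n (fun v => all_below (P^~ v) (B v)).
Proof.
move=> hP hB; apply: eq_cpt (cpt_neg (@cpt_has_below n (fun i v => ~~ P i v) B (cpt_neg hP)
  hB)) => v _.
by rewrite /has_below has_predC negbK.
Qed.

Lemma cpt_divn n F G : cpt n F -> cpt n G -> cpt n (fun v => F v %/ G v).
Proof.
move=> hF hG; have h2 : cpt2 x divn.
  have hs : cpt2 x (fun a b => if b == 0 then 0 else \sum_(i < a) (i.+1 * b <= a)).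
    apply: cpt_if; [apply: cpt_eq; [exact: cpt_nth|exact: cpt_const]|exact: cpt_const|].
    apply: (@cpt_sum 2 (fun i v => i.+1 * nth 0 v 1 <= nth 0 v 0)); last exact: cpt_nth.
    apply: cpt_leq; last exact: cpt_nth_behead.
    apply: cpt_muln; [apply: cpt_succ; exact: cpt_nth|exact: cpt_nth_behead].
  apply: eq_cpt hs => v _; case: eqP => [->|/eqP b0]; first by rewrite divn0.
  set a := nth 0 v 0; set b := nth 0 v 1 in b0 *.
  have bgt0 : 0 < b by rewrite lt0n.
  under eq_bigr => i _ do rewrite -leq_divRL //.
  rewrite -(big_mkord xpredT (fun i => nat_of_bool (i < a %/ b))).
  rewrite (big_cat_nat_idem _ (n := a %/ b)) //=; last exact: leq_div.
  rewrite (eq_big_nat _ _ (F2 := fun=> 1)) => [|i /andP[_ ->]] //.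
  rewrite sum_nat_const_nat subn0 muln1 big_nat big1 ?addn0 // => i /andP[le_i _].
  by rewrite ltnNge le_i.
exact: cpt_app2 h2 hF hG.
Qed.

Lemma cpt_modn n F G : cpt n F -> cpt n G -> cpt n (fun v => F v %% G v).
Proof.
move=> hF hG; apply: eq_cpt (cpt_subn hF (cpt_muln (cpt_divn hF hG) hG)) => v _.
by rewrite {1}(divn_eq (F v) (G v)) addKn.
Qed.

Lemma cpt_odd n F : cpt n F -> cpt n (fun v => odd (F v)).
Proof.
move=> hF; apply: eq_cpt (cpt_modn hF (cpt_const x n 2)) => v _.
by rewrite modn2.
Qed.

Lemma cpt_maxn n F G : cpt n F -> cpt n G -> cpt n (fun v => maxn (F v) (G v)).
Proof.
move=> hF hG; apply: eq_cpt (cpt_addn hF (cpt_subn hG hF)) => v _.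
by rewrite maxnE.
Qed.

(** Every positive number is a power of two times an odd number.  Both components are
    bounded by the code, so whatever is found with the help of [i] and coded by
    [pair i t] has an index at least [i]. *)
Definition pair a b := (2 ^ a * b.*2.+1).-1.
Definition unpair1 i := logn 2 i.+1.
Definition unpair2 i := (i.+1 %/ 2 ^ unpair1 i)./2.

Lemma unpair1_pair a b : unpair1 (pair a b) = a.
Proof.
rewrite /unpair1 /pair prednK ?muln_gt0 ?expn_gt0 // lognM ?expn_gt0 // pfactorK //.
by rewrite lognE /= dvdn2 /= odd_double addn0.
Qed.

Lemma unpair2_pair a b : unpair2 (pair a b) = b.
Proof.
rewrite /unpair2 unpair1_pair /pair prednK ?muln_gt0 ?expn_gt0 //.
by rewrite mulKn ?expn_gt0 // -[_.+1]/(true + b.*2) half_bit_double.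
Qed.

Lemma pairK i : pair (unpair1 i) (unpair2 i) = i.
Proof.
rewrite /pair /unpair2; set q := i.+1 %/ _.
have di : 2 ^ unpair1 i %| i.+1 by exact: pfactor_dvdnn.
have oq : odd q.
  have := @logn_div 2 _ _ di; rewrite pfactorK // subnn -/q lognE /= dvdn2.
  by case: (odd q) => //; rewrite divn_gt0 ?expn_gt0 // dvdn_leq.
have := odd_double_half q; rewrite oq add1n => ->.
by rewrite mulnC divnK.
Qed.

Lemma unpair1_le i : unpair1 i <= i.
Proof. by rewrite -ltnS; exact: ltn_logl. Qed.

Lemma unpair2_le i : unpair2 i <= i.
Proof.
rewrite -[X in _ <= X]pairK /pair.
have : 0 < 2 ^ unpair1 i by rewrite expn_gt0.
move: (2 ^ _) (unpair2 i) => a b; nia.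
Qed.

Lemma cpt_pair n F G : cpt n F -> cpt n G -> cpt n (fun v => pair (F v) (G v)).
Proof.
move=> hF hG; rewrite /pair; apply: cpt_pred; apply: cpt_muln.
  by apply: cpt_expn => //; exact: cpt_const.
apply: cpt_succ; apply: eq_cpt (cpt_addn hG hG) => v _; exact: addnn.
Qed.

Lemma cpt_unpair1 n F : cpt n F -> cpt n (fun v => unpair1 (F v)).
Proof.
move=> hF; apply: (cpt_app1 (f := unpair1)) hF; rewrite /cpt1.
have hs : cpt 1 (fun v => \sum_(i < nth 0 v 0) ((nth 0 v 0).+1 %% 2 ^ i.+1 == 0)).
  apply: (@cpt_sum 1 (fun i v => (nth 0 v 0).+1 %% 2 ^ i.+1 == 0)); last exact: cpt_nth.
  apply: cpt_eq; last exact: cpt_const.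
  apply: cpt_modn; first by apply: cpt_succ; exact: cpt_nth_behead.
  by apply: cpt_expn; [exact: cpt_const|apply: cpt_succ; exact: cpt_nth].
apply: eq_cpt hs => v _; rewrite /unpair1 logn_count_dvd //.
by rewrite big_add1 big_mkord.
Qed.

Lemma cpt_unpair2 n F : cpt n F -> cpt n (fun v => unpair2 (F v)).
Proof.
move=> hF; have h : cpt n (fun v => ((F v).+1 %/ 2 ^ unpair1 (F v)) %/ 2).
  apply: cpt_divn; last exact: cpt_const.
  apply: cpt_divn; first exact: cpt_succ.
  by apply: cpt_expn; [exact: cpt_const|exact: cpt_unpair1].
by apply: eq_cpt h => v _; rewrite divn2.
Qed.

(** Lists are coded by nested pairs.  The length is not recorded: reading past the end
    gives junk, so a bound on the index always comes with the code. *)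
Definition entry w i := unpair1 (iter i unpair2 w).

Lemma entry_exists (s : seq nat) : exists w, forall i, i < size s -> entry w i = nth 0 s i.
Proof.
elim: s => [|a s [w hw]]; first by exists 0.
by exists (pair a w) => -[|i] lt_i; rewrite /entry ?iterSr /= ?unpair1_pair // unpair2_pair;
  exact: hw.
Qed.

Lemma cpt_entry n F G : cpt n F -> cpt n G -> cpt n (fun v => entry (F v) (G v)).
Proof.
move=> hF hG; apply: cpt_unpair1.
apply: eq_cpt (@cpt_iteri x n F (fun _ z _ => unpair2 z) G hF _ hG).
  by move=> v _; elim: (G v) => //= k ->.
by apply: cpt_unpair2; exact: cpt_nth.
Qed.

End Arith.

Create HintDb cpt.
#[export] Hint Resolve cpt_const cpt_nth cpt_nth_behead cpt_nth_behead2 cpt_nth_behead3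
  cpt_succ cpt_oracle cpt_addn cpt_pred cpt_subn cpt_muln cpt_expn cpt_neg cpt_and cpt_or
  cpt_leq cpt_eq cpt_if cpt_divn cpt_modn cpt_odd cpt_maxn cpt_pair cpt_unpair1 cpt_unpair2
    cpt_entry : cpt.
Ltac cpt_auto := solve [auto 100 with cpt].

(** The argument lists that can be fed to a computable function or to a recursively
    enumerable relation. *)
Definition cpt_seq x n m (W : seq nat -> seq nat) :=
  exists Gs : nat -> seq nat -> nat, (forall i, i < m -> cpt x n (Gs i)) /\
    forall v, size v = n -> W v = mkseq (Gs^~ v) m.

(** * Relations that are recursively enumerable in the oracle *)

Section Sigma1.
Variable x : cantor.
Implicit Types (F G H : seq nat -> nat) (v : seq nat).
Local Notation cpt := (cpt x).
Local Notation cpt_seq := (cpt_seq x).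

Lemma cpt_seq_id n : cpt_seq n n id.
Proof.
exists (fun i v => nth 0 v i); split=> [i _|v sv]; first exact: cpt_nth.
by rewrite -[LHS](mkseq_nth 0) sv.
Qed.

Lemma cpt_seq_nil n : cpt_seq n 0 (fun=> [::]).
Proof. by exists (fun _ _ => 0). Qed.

Lemma cpt_seq_behead n m W : cpt_seq n m.+1 W -> cpt_seq n m (fun v => behead (W v)).
Proof.
move=> [Gs [cG eW]]; exists (fun i => Gs i.+1); split=> [i lt_i|v sv]; first exact: cG.
rewrite eW // -[RHS]/(map (fun i => Gs (1 + i)  v) (iota 0 m)).
by rewrite /mkseq /= (iotaDl 1 0) -map_comp.
Qed.

Lemma cpt_seq_cons n m F W : cpt n F -> cpt_seq n m W -> cpt_seq n m.+1 (fun v => F v :: W v).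
Proof.
move=> cF [Gs [cG eW]]; exists (fun i => if i is j.+1 then Gs j else F).
split=> [[|i] lt_i //|v sv]; first exact: cG.
by rewrite eW // /mkseq /= (iotaDl 1 0) -map_comp.
Qed.

Lemma cpt_comp_seq n m F W : cpt m F -> cpt_seq n m W -> cpt n (fun v => F (W v)).
Proof.
move=> cF [Gs [cG eW]]; apply: eq_cpt (cpt_comp cF cG) => v sv.
by rewrite eW.
Qed.

Definition re n (P : seq nat -> Prop) :=
  exists2 R : seq nat -> bool, cpt n.+1 R & forall v, size v = n -> P v <-> exists t, R (t ::
    v).

Lemma eq_re n P Q : (forall v, size v = n -> P v <-> Q v) -> re n P -> re n Q.
Proof. by move=> e [R cR hR]; exists R => // v sv; rewrite -e // hR. Qed.

Lemma re_dec n (P : seq nat -> bool) : cpt n P -> re n P.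
Proof.
move=> cP; exists (fun v => P (behead v)).
  by apply: (cpt_comp_seq cP); apply: cpt_seq_behead; exact: cpt_seq_id.
by move=> v sv; split=> [|[]] // Pv; exists 0.
Qed.

Lemma re_ex n P : re n.+1 P -> re n (fun v => exists i, P (i :: v)).
Proof.
move=> [R cR hR]; exists (fun v => R (unpair1 (nth 0 v 0) :: unpair2 (nth 0 v 0) :: behead v)).
  apply: (cpt_comp_seq cR); apply: cpt_seq_cons; first cpt_auto.
  apply: cpt_seq_cons; first cpt_auto.
  by apply: cpt_seq_behead; exact: cpt_seq_id.
move=> v sv; split=> [[i /hR[|t Rt]]|[t Rt]].
- by rewrite /= sv.
- by exists (pair t i); rewrite /= unpair1_pair unpair2_pair.
by exists (unpair2 (t)); apply/hR; rewrite /= ?sv //; exists (unpair1 t).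
Qed.

Lemma re_comp n m P W : re m P -> cpt_seq n m W -> re n (fun v => P (W v)).
Proof.
move=> [R cR hR] cW; exists (fun v => R (nth 0 v 0 :: W (behead v))).
  apply: (cpt_comp_seq cR); apply: cpt_seq_cons; first cpt_auto.
  have [Gs [cG eW]] := cW; exists (fun i v => Gs i (behead v)); split=> [i lt_i|v sv].
    by apply: (cpt_comp_seq (cG _ lt_i)); apply: cpt_seq_behead; exact: cpt_seq_id.
  by rewrite eW // size_behead sv.
move=> v sv; rewrite hR //.
by have [Gs [_ ->]] := cW; rewrite ?size_mkseq.
Qed.

(** With witnesses that stay valid when they grow, finitely many searches can share
    one bound. *)
Lemma re_mono n P : re n P -> exists2 R : seq nat -> bool, cpt n.+1 R &
  (forall v s t, s <= t -> R (s :: v) -> R (t :: v)) /\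
  forall v, size v = n -> P v <-> exists t, R (t :: v).
Proof.
move=> [R cR hR].
exists (fun v => has_below (fun i => R (i :: behead v)) (nth 0 v 0)).
  apply: (@cpt_has_below x n.+1 (fun i v => R (i :: behead v))); last cpt_auto.
  apply: (cpt_comp_seq cR); apply: cpt_seq_cons; first cpt_auto.
  by do 2!apply: cpt_seq_behead; exact: cpt_seq_id.
split=> [v s t le_st /has_belowP[/= i lt_i Ri]|v sv].
  by apply/has_belowP; exists i => //; exact: leq_trans le_st.
rewrite hR //; split=> [[t Rt]|[t /has_belowP[i /= _ Ri]]]; last by exists i.
by exists t.+1; apply/has_belowP; exists t.
Qed.

Lemma re_and n P Q : re n P -> re n Q -> re n (fun v => P v /\ Q v).
Proof.
move=> /re_mono[R cR [mR hR]] /re_mono[S cS [mS hS]].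
exists (fun v => R v && S v); first exact: cpt_and.
move=> v sv; rewrite hR // hS //; split=> [[[s Rs] [t St]]|[t /andP[Rt St]]].
  exists (maxn s t); rewrite (mR _ s) ?leq_maxl //= (mS _ t) ?leq_maxr //.
by split; exists t.
Qed.

(** The finitely many witnesses have a common bound, for which one can search. *)
Lemma re_ball n P B : re n.+1 P -> cpt n B ->
  re n (fun v => forall i, i < B v -> P (i :: v)).
Proof.
move=> /re_mono[R cR [mR hR]] cB.
exists (fun v => all_below (fun i => R (nth 0 v 0 :: i :: behead v)) (B (behead v))).
  apply: (@cpt_all_below x n.+1 (fun i v => R (nth 0 v 0 :: i :: behead v)) (fun v => B
    (behead v))).
    apply: (cpt_comp_seq cR); apply: cpt_seq_cons; first cpt_auto.
    apply: cpt_seq_cons; first cpt_auto.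
    by do 2!apply: cpt_seq_behead; exact: cpt_seq_id.
  by apply: (cpt_comp_seq cB); apply: cpt_seq_behead; exact: cpt_seq_id.
move=> v sv; split=> [h|[t /all_belowP/= h] i lt_i]; last first.
  by apply/hR; [rewrite /= sv|exists t; exact: h].
suff [t ht] : exists t, forall i, i < B v -> R [:: t, i & v].
  by exists t; apply/all_belowP.
elim: (B v) h => [|b IHb] h; first by exists 0.
have [|t ht] := IHb; first by move=> i lt_i; apply: h; exact: ltnW.
have /hR[|t' ht'] := h b (ltnSn b); first by rewrite /= sv.
exists (maxn t t') => i; rewrite ltnS leq_eqVlt => /predU1P[->|lt_i].
  by apply: mR ht'; exact: leq_maxr.
by apply: mR (ht _ lt_i); exact: leq_maxl.
Qed.

Lemma re_all n m (P : nat -> seq nat -> Prop) : (forall i, i < m -> re n (P i)) ->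
  re n (fun v => forall i, i < m -> P i v).
Proof.
elim: m => [|m IHm] h.
  by apply: eq_re (re_dec (cpt_const x n 1 : cpt n (fun=> true))) => v _.
apply: eq_re (re_and (IHm _) (h m _)) => [v _| |//].
  split=> [[hP Pm] i|hP]; last by split; [move=> i lt_i; apply: hP; exact: ltnW|exact: hP].
  by rewrite ltnS leq_eqVlt => /predU1P[->|/hP].
by move=> i lt_i; apply: h; exact: ltnW.
Qed.

End Sigma1.

(** * Kleene's normal form *)

Section NormalForm.
Variable x : cantor.
Local Notation cpt := (cpt x).
Local Notation re := (re x).

Definition eval_list n (c : code n) (v : seq nat) y :=
  exists2 w : n.-tuple nat, val w = v & eval x c w y.

Lemma eval_listE n (c : code n) (w : n.-tuple nat) y : eval_list c w y <-> eval x c w y.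
Proof. by split=> [[w' /val_inj ->]|h]; [|exists w]. Qed.

Lemma eval_list_val n (c : code n) (w : n.-tuple nat) v y : val w = v -> eval_list c v y <->
  eval x c w y.
Proof. by move=> <-; exact: eval_listE. Qed.

Lemma eval_listP n (c : code n) (v : seq nat) y (sv : size v == n) : eval_list c v y <-> eval
  x c (Tuple sv) y.
Proof. exact: (eval_listE c (Tuple sv)). Qed.

Lemma cpt_seq_iter_behead m d : cpt_seq x (d + m) m (iter d behead).
Proof.
elim: d m => [|d IHd] m; first exact: cpt_seq_id.
by apply: cpt_seq_behead; rewrite addSnnS; exact: IHd.
Qed.

Lemma tnth_nat n (w : n.-tuple nat) (i : 'I_n) : tnth w i = nth 0 w i.
Proof. exact: tnth_nth. Qed.

(** A value of a primitive recursion is justified by the list of all previous values,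
    and such a list can be searched for. *)
Lemma rec_trace (A : nat -> Prop) (G : nat -> nat -> nat -> Prop) k y :
  (fix rec (k : nat) (y : nat) : Prop :=
     match k with 0 => A y | k'.+1 => exists z, rec k' z /\ G k' z y end) k y <->
  exists s : seq nat, [/\ size s = k.+1, A (nth 0 s 0),
    forall i, i < k -> G i (nth 0 s i) (nth 0 s i.+1) & nth 0 s k = y].
Proof.
elim: k y => [|k IHk] y; split.
- by move=> hA; exists [:: y].
- by case=> s [_ hA _ <-].
- move=> [z [/IHk[s [ss hA hG hz]] hy]]; exists (rcons s y); split.
  + by rewrite size_rcons ss.
  + by rewrite nth_rcons ss.
  + move=> i; rewrite ltnS leq_eqVlt => /predU1P[->|lt_i].
      by rewrite !nth_rcons ss ltnSn ltnn eqxx hz.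
    by rewrite !nth_rcons ss !ltnS (ltnW lt_i) lt_i; exact: hG.
  + by rewrite nth_rcons ss ltnn eqxx.
move=> [s [ss hA hG <-]]; exists (nth 0 s k); split; last exact: hG.
apply/IHk; exists (take k.+1 s); split.
- by rewrite size_takel // ss.
- by rewrite nth_take.
- by move=> i lt_i; rewrite !nth_take // ?ltnS 1?ltnW //; apply: hG; exact: ltnW.
- by rewrite nth_take.
Qed.

(** Kleene's normal form, one code at a time.  For [Comp] and [Prec] the search is for a
    coded list of the intermediate values. *)
Lemma re_eval n (c : code n) : re n.+1 (fun v => eval_list c (behead v) (nth 0 v 0)).
Proof.
elim: c => {n}
  [n||n i||m n f IHf gs IHg|n f IHf g IHg|n f IHf].
- apply: eq_re (re_dec (P := fun v => nth 0 v 0 == 0) _); last by cpt_auto.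
  case=> // y v [] sv /=; have /eqP sv' := sv.
  by rewrite (eval_listP _ _ sv'); split=> /eqP.
- apply: eq_re (re_dec (P := fun v => nth 0 v 0 == (nth 0 v 1).+1) _); last by cpt_auto.
  case=> // y [|a []] // _; rewrite (eval_listE Succ [tuple a]) /=.
  by split=> /eqP.
- apply: eq_re (re_dec (P := fun v => nth 0 v 0 == nth 0 (behead v) i) _); last by cpt_auto.
  case=> // y v [] sv /=; have /eqP sv' := sv.
  by rewrite (eval_listP _ _ sv') /= tnth_nat; split=> /eqP.
- apply: eq_re (re_dec (P := fun v => nth 0 v 0 == x (nth 0 v 1) :> nat) _); last by cpt_auto.
  case=> // y [|a []] // _; rewrite (eval_listE Oracle [tuple a]) /=.
  by split=> /eqP.
- have h : re n.+1 (fun v => exists W,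
      (forall i, i < m -> (fun i u => forall lt_i : i < m, eval_list (gs (Ordinal lt_i))
        (behead (behead u)) (entry (nth 0 u 0) i)) i (W :: v)) /\
      eval_list f (mkseq (entry W) m) (nth 0 v 0)).
    apply: (@re_ex x n.+1 (fun u => (forall i, i < m -> (fun i u => forall lt_i : i < m,
      eval_list (gs (Ordinal lt_i)) (behead (behead u)) (entry (nth 0 u 0) i)) i u) /\
      eval_list f (mkseq (entry (nth 0 u 0)) m) (nth 0 u 1))).
    apply: re_and.
      apply: (@re_all _ n.+2 m) => i lt_i.
      apply: eq_re (re_comp (IHg (Ordinal lt_i)) (W := fun u => entry (nth 0 u 0) i :: behead
        (behead u)) _).
        move=> v sv /=; split=> // h lt_i'.
        by rewrite (bool_irrelevance lt_i' lt_i).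
      by apply: cpt_seq_cons; [cpt_auto|exact: (@cpt_seq_iter_behead n 2)].
    apply: (re_comp IHf (W := fun u => nth 0 u 1 :: mkseq (entry (nth 0 u 0)) m)).
    apply: cpt_seq_cons; first cpt_auto.
    by exists (fun i u => entry (nth 0 u 0) i); split=> // i _; cpt_auto.
  apply: eq_re h; case=> // y v [] sv /=; have /eqP sv' := sv.
  rewrite (eval_listP (Comp f gs) _ sv') /=; split=> [[W [hW hf]]|[w [hw hf]]].
    exists [tuple entry W i | i < m]; split.
      move=> i; rewrite tnth_mktuple; have := hW i (ltn_ord i) (ltn_ord i).
      have -> : Ordinal (ltn_ord i) = i by exact: val_inj.
      by rewrite (eval_listP _ _ sv').
    case: hf => w ew hf; suff -> : [tuple entry W i | i < m] = w by [].
    apply: val_inj; rewrite ew; apply: (@eq_from_nth _ 0); rewrite size_tuple ?size_mkseq //.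
    move=> i lt_i; rewrite nth_mkseq //.
    by rewrite -[LHS](tnth_nat (mktuple _) (Ordinal lt_i)) tnth_mktuple.
  have [W hW] := entry_exists w; rewrite size_tuple in hW.
  exists W; split=> [i lt_i lt_i'|].
    by apply/(eval_listP _ _ sv'); rewrite hW // -(tnth_nat w (Ordinal lt_i')).
  suff -> : mkseq (entry W) m = w by exact/eval_listE.
  apply: (@eq_from_nth _ 0); rewrite size_mkseq ?size_tuple //.
  by move=> i lt_i; rewrite nth_mkseq ?hW.
- have h : re n.+2 (fun v => exists W, eval_list f (behead (behead v)) (entry W 0) /\
     (forall i, i < nth 0 v 1 -> eval_list g (i :: entry W i :: behead (behead v)) (entry W
       i.+1)) /\
     (entry W (nth 0 v 1) == nth 0 v 0)).
    apply: (@re_ex x n.+2 (fun u => eval_list f (behead (behead (behead u))) (entry (nth 0 u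
      0) 0) /\
     (forall i, i < nth 0 u 2 -> eval_list g (i :: entry (nth 0 u 0) i :: behead (behead
       (behead u))) (entry (nth 0 u 0) i.+1)) /\
     (entry (nth 0 u 0) (nth 0 u 2) == nth 0 u 1))).
    apply: re_and.
      apply: (re_comp IHf (W := fun u => entry (nth 0 u 0) 0 :: behead (behead (behead u)))).
      by apply: cpt_seq_cons; [cpt_auto|exact: (@cpt_seq_iter_behead n 3)].
    apply: re_and; last by apply: re_dec; cpt_auto.
    apply: (@re_ball _ _ (fun u => eval_list g (nth 0 u 0 :: entry (nth 0 u 1) (nth 0 u 0) ::
      behead (behead (behead (behead u))))
      (entry (nth 0 u 1) (nth 0 u 0).+1))); last by cpt_auto.
    apply: (re_comp IHg (W := fun u => entry (nth 0 u 1) (nth 0 u 0).+1 :: nth 0 u 0 :: entry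
      (nth 0 u 1) (nth 0 u 0) :: behead (behead (behead (behead u))))).
    do 3!(apply: cpt_seq_cons; first cpt_auto).
    exact: (@cpt_seq_iter_behead n 4).
  apply: eq_re h; case=> // y [|k v] // [] sv; have /eqP sv' := sv; move=> /=.
  have sk : size (k :: v) == n.+1 by rewrite /= sv.
  rewrite (eval_listP (Prec f g) _ sk) /=.
  have -> : thead (Tuple sk) = k by [].
  have ef z : eval_list f v z <-> eval x f [tuple of behead (Tuple sk)] z by exact:
    (eval_list_val f).
  have eg i z y' : eval_list g [:: i, z & v] y' <->
    eval x g [tuple of i :: z :: [tuple of behead (Tuple sk)]] y' by exact: (eval_list_val g).
  apply: iff_trans (iff_sym (rec_trace (eval x f [tuple of behead (Tuple sk)])
    (fun i z => eval x g [tuple of i :: z :: [tuple of behead (Tuple sk)]]) k y)).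
  split=> [[W [hf [hg /eqP <-]]]|[s [ss /ef hf hg hy]]].
    exists (mkseq (entry W) k.+1); rewrite size_mkseq !nth_mkseq //; split=> //; first exact/ef.
    by move=> i lt_i; rewrite !nth_mkseq // 1?ltnW //; apply/eg; exact: hg.
  have [W hW] := entry_exists s; exists W; rewrite !hW ?ss // hy eqxx; split=> //.
  by split=> // i lt_i; rewrite !hW ?ss //; [apply/eg; exact: hg|exact: ltnW].
- have h : re n.+1 (fun v => eval_list f v 0 /\ forall k, k < nth 0 v 0 -> exists z,
  eval_list f (k :: behead v) z.+1).
    apply: re_and.
      apply: (re_comp IHf (W := fun u => 0 :: u)).
      by apply: cpt_seq_cons; [cpt_auto|exact: cpt_seq_id].
    apply: (@re_ball _ _ (fun u => exists z, eval_list f (nth 0 u 0 :: behead (behead u))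
      z.+1)); last by cpt_auto.
    apply: (@re_ex _ _ (fun u => eval_list f (nth 0 u 1 :: behead (behead (behead u))) (nth 0
      u 0).+1)).
    apply: (re_comp IHf (W := fun u => (nth 0 u 0).+1 :: nth 0 u 1 :: behead (behead (behead
      u)))).
    do 2!(apply: cpt_seq_cons; first cpt_auto).
    exact: (@cpt_seq_iter_behead n 3).
  apply: eq_re h; case=> // y v [] sv /=; have /eqP sv' := sv.
  rewrite (eval_listP (Mu f) _ sv') /=.
  have e k z : eval_list f (k :: v) z <-> eval x f [tuple of k :: Tuple sv'] z by exact:
    (eval_listE f [tuple of k :: Tuple sv']).
  by rewrite e; split=> -[h0 h]; split=> // k /h[z hz]; exists z; exact/e.
Qed.

End NormalForm.

(** * Machines given by their graphs *)

Section Machines.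
Variable x : cantor.
Local Notation cpt := (cpt x).
Local Notation re := (re x).

Definition graph (M : pfun_str) a b := M (str_of_nat a) = Some (str_of_nat b).

Lemma re_graph M : computable_in x M -> re 2 (fun v => graph M (nth 0 v 0) (nth 0 v 1)).
Proof.
move=> [c hc]; apply: eq_re (re_comp (re_eval x c) (W := fun v => [:: nth 0 v 1; nth 0 v 0])
  _); last first.
  by do 2!(apply: cpt_seq_cons; first cpt_auto); exact: cpt_seq_nil.
move=> [|a [|b []]] //= _; rewrite (eval_listE x c [tuple a]) /graph.
by have := hc (str_of_nat a) (str_of_nat b); rewrite !str_of_natK => ->.
Qed.

Definition machine_of (G : nat -> nat -> Prop) : pfun_str := fun s =>
  if pselect (exists b, G (nat_of_str s) b) is left ex
  then Some (str_of_nat (projT1 (cid ex))) else None.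

Lemma machine_ofP G s t : (forall a b b', G a b -> G a b' -> b = b') ->
  machine_of G s = Some t <-> G (nat_of_str s) (nat_of_str t).
Proof.
move=> fG; rewrite /machine_of; case: pselect => [ex|nex]; last first.
  by split=> // h; case: nex; exists (nat_of_str t).
case: cid => b hb /=; split=> [[<-]|h]; first by rewrite str_of_natK.
by rewrite (fG _ _ _ hb h) nat_of_strK.
Qed.

Lemma machine_of_dom G s : machine_of G s <> None -> exists b, G (nat_of_str s) b.
Proof. by rewrite /machine_of; case: pselect. Qed.

(** The code looks for the first pair of an output and a witness for it; whichever
    output comes first is the right one because the relation is single-valued. *)
Lemma machine_of_computable G : (forall a b b', G a b -> G a b' -> b = b') ->
  re 2 (fun v => G (nth 0 v 0) (nth 0 v 1)) -> computable_in x (machine_of G).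
Proof.
move=> fG [R cR hR].
have [f hf] : cpt 2 (fun v => ~~ R [:: unpair2 (nth 0 v 0); nth 0 v 1; unpair1 (nth 0 v 0)]).
  apply: cpt_neg; apply: (cpt_comp_seq cR).
  by do 3!(apply: cpt_seq_cons; first cpt_auto); exact: cpt_seq_nil.
have [g hg] : cpt 1 (fun v => unpair1 (nth 0 v 0)) by cpt_auto.
exists (Comp g (fun _ : 'I_1 => Mu f)) => s t; rewrite machine_ofP //.
set a := nat_of_str s; set b := nat_of_str t.
rewrite (hR [:: a; b]) //=; split=> [[t0 Rt]|[w [hw /hg ->]]]; last first.
  have {hw} [/hf /= h _] := hw ord0; exists (unpair2 (nth 0 w 0)).
  by move: h; rewrite (tnth_nth 0) /=; case: (R _).
have ex : exists i, R [:: unpair2 i; a; unpair1 i] by exists (pair b t0); rewrite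
  unpair1_pair unpair2_pair.
exists [tuple ex_minn ex]; split.
  move=> i; rewrite (tnth_nth 0) ord1 /=; case: ex_minnP => m Rm min_m; split.
    by apply/hf; rewrite /= Rm.
  move=> k lt_km; exists 0; apply/hf => /=.
  by case Rk: (R _) => //; have := min_m _ Rk; rewrite leqNgt lt_km.
apply/hg => /=; case: ex_minnP => m Rm _.
by apply: (fG a); apply/(hR [:: a; _]) => //=; [exists t0|exists (unpair2 m)].
Qed.

(** An element is enumerated at the index that pairs it with its first witness, which
    makes the index unique.  The parameter [c] gives uniformly enumerable families. *)
Lemma re_enum (P : nat -> nat -> Prop) : re 2 (fun v => P (nth 0 v 0) (nth 0 v 1)) ->
  exists2 val : nat -> pred nat, cpt2 x val &
    (forall c a, P c a <-> exists2 i, val c i & unpair1 i = a) /\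
    (forall c i j, val c i -> val c j -> unpair1 i = unpair1 j -> i = j).
Proof.
move=> [R cR hR].
exists (fun c i => R [:: unpair2 i; c; unpair1 i] && all_below (fun t => ~~ R [:: t; c;
  unpair1 i]) (unpair2 i)).
  apply: cpt_and.
    apply: (cpt_comp_seq cR).
    by do 3!(apply: cpt_seq_cons; first cpt_auto); exact: cpt_seq_nil.
  apply: (@cpt_all_below _ 2 (fun t v => ~~ R [:: t; nth 0 v 0; unpair1 (nth 0 v 1)]) (fun v
    => unpair2 (nth 0 v 1))); last cpt_auto.
  apply: cpt_neg; apply: (cpt_comp_seq cR).
  by do 3!(apply: cpt_seq_cons; first cpt_auto); exact: cpt_seq_nil.
split=> [c a|c i j].
  split=> [/(hR [:: c; a])[//|t Rt]|[i /andP[Ri _] <-]]; last by apply/(hR [:: c; _]) => //;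
    exists (unpair2 i).
  have ex : exists t, R [:: t; c; a] by exists t.
  case: (ex_minnP ex) => m Rm min_m; exists (pair a m); rewrite ?unpair1_pair ?unpair2_pair
    // Rm /=.
  by apply/all_belowP => k; rewrite ltnNge; apply: contra => /min_m.
move=> /andP[Ri /all_belowP mi] /andP[Rj /all_belowP mj] e; rewrite -(pairK i) -(pairK j) e.
congr pair; case: (ltngtP (unpair2 i) (unpair2 j)) => // h.
  by have := mj _ h; rewrite -e Ri.
by have := mi _ h; rewrite e Rj.
Qed.

End Machines.

Section OracleFree.

(** The empty oracle answers [0], as the constant [Zero] does. *)
Fixpoint forget_oracle n (c : code n) : code n := match c with
  | Zero n => Zero n | Succ => Succ | Proj _ i => Proj i
  | Oracle => Zero 1
  | Comp _ _ f gs => Comp (forget_oracle f) (fun i => forget_oracle (gs i))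
  | Prec _ f g => Prec (forget_oracle f) (forget_oracle g)
  | Mu _ f => Mu (forget_oracle f) end.

Lemma eval_forget_oracle x n (c : code n) v y : eval (fun=> false) c v y <-> eval x
  (forget_oracle c) v y.
Proof.
elim: c v y => {n} //= [m n f IHf gs IHg|n f IHf g IHg|n f IHf] v y.
- by split=> -[w [hw hf]]; exists w; (split; first by move=> i; apply/IHg); apply/IHf.
- elim: (thead v) y => [|k IHk] y /=; first exact: IHf.
  by split=> -[z [/IHk hz /IHg hg]]; exists z.
- by split=> -[/IHf h0 h]; (split=> // k /h[z hz]); exists z; apply/IHf.
Qed.

Lemma computable_oracle x M : computable_in (fun=> false) M -> computable_in x M.
Proof.
move=> [c hc]; exists (forget_oracle c) => s t; rewrite hc; exact: eval_forget_oracle.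
Qed.

End OracleFree.

(** * Arithmetic of strings *)

(** Here the first bit is the most significant one, as in the binary expansion of a real;
    in [nat_of_str] it is the least significant one. *)
Definition val_str (s : str) := foldl (fun a (b : bool) => a.*2 + b) 0 s.

Fixpoint bits k v : str := if k is k'.+1 then rcons (bits k' v./2) (odd v) else [::].

Lemma val_rcons s b : val_str (rcons s b) = (val_str s).*2 + b.
Proof. by rewrite /val_str foldl_rcons. Qed.

Lemma val_cat s t : val_str (s ++ t) = val_str s * 2 ^ size t + val_str t.
Proof.
elim/last_ind: t => [|t b IHt]; first by rewrite cats0 muln1 addn0.
by rewrite -rcons_cat !val_rcons IHt size_rcons expnS; lia.
Qed.

Lemma val_cons b s : val_str (b :: s) = b * 2 ^ size s + val_str s.
Proof. by rewrite -cat1s val_cat /val_str /= add0n. Qed.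

Lemma val_lt s : val_str s < 2 ^ size s.
Proof.
elim/last_ind: s => [|s b IHs] //.
by rewrite val_rcons size_rcons expnS; case: b; lia.
Qed.

Lemma val_str_inj s t : size s = size t -> val_str s = val_str t -> s = t.
Proof.
elim/last_ind: s t => [|s b IHs] t; first by case: t.
elim/last_ind: t => [|t c _]; rewrite !size_rcons // => -[e].
rewrite !val_rcons => e'; have ebc : b = c by case: b c e' => [] [] //; lia.
by rewrite ebc (IHs t) //; rewrite ebc in e'; lia.
Qed.

Lemma size_bits k v : size (bits k v) = k.
Proof. by elim: k v => //= k IHk v; rewrite size_rcons IHk. Qed.

Lemma val_bits k v : v < 2 ^ k -> val_str (bits k v) = v.
Proof.
elim: k v => [|k IHk] v /=; first by case: v.
rewrite expnS => lt_v; rewrite val_rcons IHk; last by lia.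
by rewrite addnC odd_double_half.
Qed.

Lemma prefix_val (s t : str) : prefix s t ->
  val_str s * 2 ^ (size t - size s) <= val_str t < (val_str s).+1 * 2 ^ (size t - size s).
Proof.
move=> /prefixP[u ->]; rewrite val_cat size_cat addKn mulSn.
by have := val_lt u; lia.
Qed.

Lemma val_prefix (s t : str) : size s <= size t ->
  val_str s * 2 ^ (size t - size s) <= val_str t < (val_str s).+1 * 2 ^ (size t - size s) ->
  prefix s t.
Proof.
move=> le_st; have -> : val_str t = val_str (take (size s) t) * 2 ^ (size t - size s) +
    val_str (drop (size s) t) by rewrite -{1}(cat_take_drop (size s) t) val_cat size_drop.
set d := size t - size s; set a := val_str (take _ _).
have := val_lt (drop (size s) t); rewrite size_drop -/d => lt_d h.
suff e : val_str s = a by rewrite prefixE; apply/eqP/val_str_inj; rewrite ?size_takel.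
move: h lt_d; move: (2 ^ d) (val_str s) (val_str (drop _ _)) => u b c /andP[h1 h2] h3.
case: (ltngtP b a) => // h.
  have hh : b.+1 * u <= a * u by rewrite leq_mul2r h orbT.
  lia.
by have hh : a.+1 * u <= b * u; [rewrite leq_mul2r h orbT|lia].
Qed.

Lemma val_sum s : val_str s = \sum_(i < size s) nth false s i * 2 ^ (size s - i.+1).
Proof.
elim: s => [|b s IHs]; first by rewrite big_ord0.
by rewrite val_cons big_ord_recl /= subn1 IHs; congr addn; apply: eq_bigr.
Qed.

(** Among strings of one length the lexicographic order is the numerical one. *)
Lemma leL_val s x : leL s x <-> val_str s <= val_str (mkseq x (size s)).
Proof.
rewrite /leL /ltL; set t := mkseq x _.
have st : size t = size s by rewrite size_mkseq.
have -> : (exists n, [/\ n < size s, take n s = mkseq x n, nth false s n = false & x n =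
  true]) <->
  exists n, [/\ n < size s, take n s = take n t, nth false s n = false & nth false t n = true].
  by split=> -[n [lt_n e1 e2 e3]]; exists n; move: e1 e3; rewrite nth_mkseq // /t /mkseq
    -map_take take_iota (minn_idPl (ltnW lt_n)).
move: t st => t; elim: s t => [|b s IHs] [|c t] //=.
  by move=> _; split=> // _; right.
move=> [st]; have := IHs t st; rewrite !val_cons st => {}IHs.
split=> [[[[|n] [lt_n /= e1 e2 e3]]|[-> ->]]//|].
- by rewrite e2 e3; have := val_lt s; lia.
- case: e1 => -> e1; rewrite leq_add2l; apply/IHs; left; by exists n.
have [lt_s lt_t] := (val_lt s, val_lt t); rewrite st in lt_t.
case: b c => [] [] /=; rewrite ?mul1n ?mul0n ?add0n ?leq_add2l.
- move=> /IHs[[n [? ? ? ?]]|->]; last by right.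
  by left; exists n.+1; split=> //=; congr cons.
- by lia.
- by move=> _; left; exists 0.
- move=> /IHs[[n [? ? ? ?]]|->]; last by right.
  by left; exists n.+1; split=> //=; congr cons.
Qed.

(** In base 2, one plus the code of [s] is a leading [1] followed by the bits of [s], the
    last one first; this is how the bits are recovered from the code. *)
Lemma nat_of_strE s : (nat_of_str s).+1 = 2 ^ size s + \sum_(i < size s) nth false s i * 2 ^ i.
Proof.
elim: s => [|b s IHs]; first by rewrite big_ord0.
rewrite -[size (b :: s)]/(size s).+1 big_ord_recl expnS expn0 muln1.
have -> : \sum_(i < size s) nth false (b :: s) (lift ord0 i) * 2 ^ lift ord0 i =
    2 * \sum_(i < size s) nth false s i * 2 ^ i.
  by rewrite big_distrr; apply: eq_bigr => i _; rewrite lift0 expnS mulnCA.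
rewrite [nat_of_str (b :: s)]/= [nth _ _ ord0]/=.
by rewrite addnCA -mulnDr -IHs; case: (b) => /=; lia.
Qed.

Lemma sum_bits_lt k (b : nat -> bool) : \sum_(i < k) b i * 2 ^ i < 2 ^ k.
Proof.
elim: k => [|k IHk]; first by rewrite big_ord0.
rewrite big_ord_recr expnS /=; move: IHk; move: (\sum_(i < k) _) => S; by case: (b k) => /=;
  lia.
Qed.

Lemma size_code s i : (i < size s) = (2 ^ i.+1 <= (nat_of_str s).+1).
Proof.
have h := nat_of_strE s; have lt := sum_bits_lt (size s) (nth false s).
have [lt_i|le_i] := ltnP i (size s).
  have hh : 2 ^ i.+1 <= 2 ^ size s by rewrite leq_exp2l.
  by apply/esym; lia.
apply/esym/negbTE; rewrite -ltnNge h.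
have : 2 ^ (size s).+1 <= 2 ^ i.+1 by rewrite leq_exp2l // ltnS.
by rewrite expnS; lia.
Qed.

Lemma nth_code s i : i < size s -> nth false s i = odd ((nat_of_str s).+1 %/ 2 ^ i).
Proof.
elim: s i => [|b s IHs] [|i] //=.
  by move=> _; rewrite divn1; case: b; rewrite !addnS addn0 /= ?negbK ?oddD odd_double.
move=> lt_i; rewrite IHs // expnS divnMA; congr (odd (_ %/ _)).
by case: b; lia.
Qed.

Lemma nat_of_cat s t : nat_of_str (s ++ t) = nat_of_str s + 2 ^ size s * nat_of_str t.
Proof.
elim: s => [|b s IHs] /=; first by rewrite mul1n.
by rewrite IHs expnS; lia.
Qed.

Lemma nat_of_bits k v : nat_of_str (bits k v) =
  (2 ^ k + \sum_(i < k) odd (v %/ 2 ^ (k - i.+1)) * 2 ^ i).-1.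
Proof.
have nthb i : i < k -> nth false (bits k v) i = odd (v %/ 2 ^ (k - i.+1)).
  elim: k v => [|k IHk] v //=; rewrite ltnS nth_rcons size_bits => le_i.
  case: ltngtP le_i => // [lt_i|->] _; last by rewrite subnn divn1.
  by rewrite IHk // subSn // expnS divnMA divn2.
rewrite -[LHS]/(_.+1.-1) nat_of_strE size_bits; congr (_ + _).-1.
by apply: eq_bigr => i _; rewrite nthb.
Qed.

Definition szn a := size (str_of_nat a).
Definition valn a := val_str (str_of_nat a).
Definition catn a b := nat_of_str (str_of_nat a ++ str_of_nat b).
Definition bitsn k v := nat_of_str (bits k v).

Section Codes.
Variable x : cantor.
Implicit Types (F G : seq nat -> nat).
Local Notation cpt := (cpt x).

Lemma szn_le a : szn a <= a.
Proof.
rewrite -{2}(str_of_natK a) /szn; elim: (str_of_nat a) => //= b s; case: b; lia.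
Qed.

Lemma cpt_szn n F : cpt n F -> cpt n (fun v => szn (F v)).
Proof.
move=> hF; apply: (cpt_app1 (f := szn)) hF.
have h : cpt 1 (fun v => \sum_(i < nth 0 v 0) (2 ^ i.+1 <= (nth 0 v 0).+1)).
  by apply: (@cpt_sum x 1 (fun i v => 2 ^ i.+1 <= (nth 0 v 0).+1)); cpt_auto.
apply: eq_cpt h => v _; set a := nth 0 v 0.
have e i : (2 ^ i.+1 <= a.+1) = (i < szn a) by rewrite -{1}(str_of_natK a) -size_code.
under eq_bigr => i _ do rewrite e.
rewrite -(big_mkord xpredT (fun i => nat_of_bool (i < szn a))).
rewrite (big_cat_nat_idem _ (n := szn a)) //=; last exact: szn_le.
rewrite (eq_big_nat _ _ (F2 := fun=> 1)) => [|i /andP[_ ->]] //.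
rewrite sum_nat_const_nat subn0 muln1 big_nat big1 ?addn0 // => i /andP[le_i _].
by rewrite ltnNge le_i.
Qed.

Lemma cpt_valn n F : cpt n F -> cpt n (fun v => valn (F v)).
Proof.
move=> hF; apply: (cpt_app1 (f := valn)) hF.
have h : cpt 1 (fun v => \sum_(i < szn (nth 0 v 0)) odd ((nth 0 v 0).+1 %/ 2 ^ i) * 2 ^ (szn
  (nth 0 v 0) - i.+1)).
  apply: (@cpt_sum x 1 (fun i v => odd ((nth 0 v 0).+1 %/ 2 ^ i) * 2 ^ (szn (nth 0 v 0) -
    i.+1))).
    apply: cpt_muln; first cpt_auto.
    apply: cpt_expn; first cpt_auto.
    apply: cpt_subn; last cpt_auto.
    by apply: cpt_szn; cpt_auto.
  by apply: cpt_szn; cpt_auto.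
apply: eq_cpt h => v _; rewrite /valn val_sum; apply: eq_bigr => i _.
by rewrite nth_code // str_of_natK.
Qed.

Lemma cpt_catn n F G : cpt n F -> cpt n G -> cpt n (fun v => catn (F v) (G v)).
Proof.
move=> hF hG.
apply: eq_cpt (_ : cpt n (fun v => F v + 2 ^ szn (F v) * G v)) => [v _|].
  by rewrite /catn nat_of_cat !str_of_natK.
by have := cpt_szn hF; cpt_auto.
Qed.

Lemma cpt_bitsn n F G : cpt n F -> cpt n G -> cpt n (fun v => bitsn (F v) (G v)).
Proof.
move=> hF hG; have h2 : cpt2 x bitsn; last exact: cpt_app2 h2 hF hG.
have h : cpt 2 (fun v => (2 ^ nth 0 v 0 + \sum_(i < nth 0 v 0)
    odd (nth 0 v 1 %/ 2 ^ (nth 0 v 0 - i.+1)) * 2 ^ i).-1).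
  apply: cpt_pred; apply: cpt_addn; first cpt_auto.
  by apply: (@cpt_sum x 2 (fun i v => odd (nth 0 v 1 %/ 2 ^ (nth 0 v 0 - i.+1)) * 2 ^ i));
    cpt_auto.
by apply: eq_cpt h => v _; rewrite /bitsn nat_of_bits.
Qed.

Lemma cpt_leL n F : cpt n F -> cpt n (fun v => `[< leL (str_of_nat (F v)) x >]).
Proof.
move=> hF; apply: (cpt_app1 (f := fun a => nat_of_bool `[< leL (str_of_nat a) x >])) hF.
have h : cpt 1 (fun v => valn (nth 0 v 0) <= \sum_(i < szn (nth 0 v 0)) x i * 2 ^ (szn (nth 0
  v 0) - i.+1)).
  apply: cpt_leq; first by apply: cpt_valn; cpt_auto.
  apply: (@cpt_sum x 1 (fun i v => x i * 2 ^ (szn (nth 0 v 0) - i.+1))); last by apply: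
    cpt_szn; cpt_auto.
  apply: cpt_muln; first cpt_auto.
  apply: cpt_expn; first cpt_auto.
  by apply: cpt_subn; [apply: cpt_szn|]; cpt_auto.
apply: eq_cpt h => v _; congr nat_of_bool; set a := nth 0 v 0.
have -> : \sum_(i < szn a) x i * 2 ^ (szn a - i.+1) = val_str (mkseq x (szn a)).
  by rewrite val_sum size_mkseq; apply: eq_bigr => i _; rewrite nth_mkseq.
by apply/idP/asboolP => h; apply/leL_val.
Qed.

End Codes.
#[export] Hint Resolve cpt_szn cpt_valn cpt_catn cpt_bitsn cpt_leL : cpt.

Local Open Scope ring_scope.
Local Open Scope classical_set_scope.

(** * Complexity and Kraft's inequality *)

Lemma K_cases M s :
  (exists2 k : nat, K M s = k%:Z%:E & (exists2 t, M t = Some s & size t = k) /\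
     forall t, M t = Some s -> (k <= size t)%N) \/
  (K M s = +oo%E /\ forall t, M t <> Some s).
Proof.
rewrite /K; case: pselect => [ex|nex]; last first.
  right; split=> // t e; apply: nex; exists (size t); apply/asboolP; by exists t.
left; case: ex_minnP => k /asboolP[t [e st]] min_k; exists k => //; split; first by exists t.
by move=> t' e'; apply: min_k; apply/asboolP; exists t'.
Qed.

Lemma K_le M s k : (K M s <= k%:Z%:E)%E <-> exists2 t, M t = Some s & (size t <= k)%N.
Proof.
have [[j -> [[t e st] min_j]]|[-> h]] := K_cases M s; last first.
  by split=> // -[t /h].
rewrite lee_fin lez_nat; split=> [le_jk|[t' /min_j/leq_trans]]; last by apply.
by exists t; rewrite ?st.
Qed.

Section Dyadic.
Variable R : realType.

Definition pw k : R := 2^-1 ^+ k.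

Lemma pw_gt0 k : 0 < pw k.
Proof. by rewrite exprn_gt0 // invr_gt0. Qed.

Lemma pwD i j : pw (i + j) = pw i * pw j.
Proof. exact: exprD. Qed.

Lemma pwS k : pw k.+1 = 2^-1 * pw k.
Proof. exact: exprS. Qed.

Lemma pwS2 k : pw k = pw k.+1 + pw k.+1.
Proof. by rewrite pwS; lra. Qed.

Lemma pw_natM k : pw k * (2 ^ k)%N%:R = 1.
Proof. by rewrite natrX -exprMn mulVf ?expr1n. Qed.

Lemma pw_sub D k : (k <= D)%N -> (2 ^ (D - k))%N%:R * pw D = pw k.
Proof.
move=> le_kD; have -> : pw D = pw (D - k) * pw k by rewrite -pwD subnK.
by rewrite mulrA (mulrC _%:R) pw_natM mul1r.
Qed.

Lemma le_pw i j : (pw i <= pw j) = (j <= i)%N.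
Proof. by rewrite ler_iXn2l // ?invr_gt0 ?invf_lt1 ?ltr1n. Qed.

(** The real [0.s], the left end of the interval of [s]. *)
Definition binreal (s : str) : R := (val_str s)%:R * pw (size s).

Lemma binreal_top s : binreal s + pw (size s) = (val_str s).+1%:R * pw (size s).
Proof. by rewrite -natr1 mulrDl mul1r. Qed.

Lemma binreal_prefix s t : prefix s t -> binreal s <= binreal t /\ binreal t + pw (size t) <=
  binreal s + pw (size s).
Proof.
move=> pst; have /andP[h1 h2] := prefix_val pst.
have le_st : (size s <= size t)%N by exact: size_prefix.
rewrite !binreal_top /binreal -(pw_sub le_st) !mulrA -!natrM.
by rewrite !ler_pM2r ?pw_gt0 // !ler_nat.
Qed.

Lemma prefix_binreal s t : binreal s <= binreal t -> binreal t + pw (size t) <= binreal s +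
  pw (size s) -> prefix s t.
Proof.
move=> h1 h2; have le_st : (size s <= size t)%N by rewrite -le_pw; move: h1 h2; lra.
apply: val_prefix => //; move: h1 h2.
rewrite !binreal_top /binreal -(pw_sub le_st) !mulrA -!natrM.
by rewrite !ler_pM2r ?pw_gt0 // !ler_nat => -> ->.
Qed.

(** A prefix-free set other than the one of the empty string splits by the first bit into
    two prefix-free sets of half the weight. *)
Lemma kraft_seq (s : seq str) : uniq s ->
  (forall p q, p \in s -> q \in s -> prefix p q -> p = q) ->
  \sum_(p <- s) pw (size p) <= 1.
Proof.
have [L] : exists L, forall p, p \in s -> (size p <= L)%N.
  exists (\max_(p <- s) size p)%N => p ps; exact: leq_bigmax_seq.
elim: L s => [|L IHL] s hL us pf.
  have hnil p : p \in s -> p = [::] by move=> /hL; case: p.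
  case: s us hnil {pf hL} => [|p [|q s]] us hnil.
  - by rewrite big_nil ler01.
  - by rewrite big_seq1 (hnil p) ?mem_head.
  - by move: us; rewrite (hnil p) ?mem_head // (hnil q) ?inE ?eqxx ?orbT.
have [nil_s|nil_s] := boolP ([::] \in s).
  have hnil p : p \in s -> p = [::] by move=> ps; apply/esym/pf; rewrite ?prefix0s.
  case: s us hnil {pf hL nil_s} => [|p [|q s]] us hnil.
  - by rewrite big_nil ler01.
  - by rewrite big_seq1 (hnil p) ?mem_head.
  - by move: us; rewrite (hnil p) ?mem_head // (hnil q) ?inE ?eqxx ?orbT.
(* What follows the first bit of the strings that start with [b]. *)
pose sb b := [seq behead p | p <- s & head false p == b].
have cons_s b p : p \in sb b -> b :: p \in s.
  move=> /mapP[[|c q]]; rewrite mem_filter => /andP[/eqP hq qs] ->; first by rewrite qs in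
    nil_s.
  by rewrite -hq.
have half b : \sum_(p <- s | head false p == b) pw (size p) <= 2^-1.
  have -> : \sum_(p <- s | head false p == b) pw (size p) = 2^-1 * \sum_(p <- sb b) pw (size p).
    rewrite big_map big_filter big_distrr /= big_seq_cond [RHS]big_seq_cond.
    apply: eq_bigr => -[|c p] /andP[ps _]; first by rewrite ps in nil_s.
    by rewrite -pwS.
  rewrite -[leRHS]mulr1 ler_pM2l ?invr_gt0 //; apply: IHL.
  - by move=> p /cons_s/hL.
  - rewrite map_inj_in_uniq ?filter_uniq // => -[|c p] [|d q]; rewrite !mem_filter.
    + by [].
    + by move=> /andP[_ h]; rewrite h in nil_s.
    + by move=> _ /andP[_ h]; rewrite h in nil_s.
    + by move=> /andP[/eqP /= -> _] /andP[/eqP /= -> _] ->.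
  - move=> p q /cons_s ps /cons_s qs pq.
    by have [] : b :: p = b :: q by apply: pf; rewrite //= eqxx.
rewrite (bigID (fun p => head false p == true)) /=.
under [X in _ + X]eq_bigl => p do rewrite eqb_id -eqbF_neg.
by have := half true; have := half false; lra.
Qed.

Lemma kraft_fam n (P : pred nat) (q : nat -> str) :
  (forall i j, P i -> P j -> prefix (q i) (q j) -> i = j) ->
  \sum_(i < n | P i) pw (size (q i)) <= 1.
Proof.
move=> h; rewrite -(big_mkord P (fun i => pw (size (q i)))).
rewrite /index_iota subn0 -big_filter -(big_map q xpredT (fun p => pw (size p))).
apply: kraft_seq.
  rewrite map_inj_in_uniq ?filter_uniq ?iota_uniq // => i j; rewrite !mem_filter.
  by move=> /andP[Pi _] /andP[Pj _] e; apply: h => //; rewrite e prefix_refl.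
move=> p p' /mapP[i + ->] /mapP[j + ->]; rewrite !mem_filter.
by move=> /andP[Pi _] /andP[Pj _] /h -> .
Qed.

Lemma prefix_catP (T : eqType) (a b u v : seq T) : prefix (a ++ u) (b ++ v) ->
  prefix a b \/ prefix b a.
Proof.
elim: a b => [|c a IHa] [|d b] /=; [by left|by left|by right|].
by move=> /andP[/eqP -> /IHa[]]; rewrite eqxx; [left|right].
Qed.

Lemma prefix_catI (T : eqType) (a u v : seq T) : prefix (a ++ u) (a ++ v) = prefix u v.
Proof. by rewrite prefix_catr ?eqxx. Qed.

(** Let [r] be a shortest program for [s].  The string [r ++ 1^a ++ 0] of length [k - c]
    determines both [s] and [k], and all these strings together are prefix-free. *)
Lemma kraft_requests (V : pfun_str) (c n : nat) (P : pred nat) (k : nat -> nat) (m : nat ->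
  str) :
  prefix_free [set s | V s <> None] ->
  (forall i, P i -> exists2 r, V r = Some (m i) & (size r + c < k i)%N) ->
  (forall i j, P i -> P j -> k i = k j -> m i = m j -> i = j) ->
  \sum_(i < n | P i) pw (k i) <= pw c.
Proof.
move=> pfV hP inj.
have /choice[sp hsp] : forall s, exists r, forall t, V t = Some s -> V r = Some s /\ (size r
  <= size t)%N.
  move=> s; have [[j _ [[r e sr] min_r]]|[_ h]] := K_cases V s; last by exists [::] => t /h.
  by exists r => t /min_r; rewrite sr.
pose q i := sp (m i) ++ nseq (k i - c - size (sp (m i))).-1 true ++ [:: false].
have hq i : P i -> V (sp (m i)) = Some (m i) /\ (size (sp (m i)) + c < k i)%N.
  by move=> /hP[r /hsp[-> le_r] lt_r]; split=> //; apply: leq_ltn_trans lt_r; rewrite leq_add2r.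
have sq i : P i -> size (q i) = (k i - c)%N.
  by move=> /hq[_ lt_k]; rewrite !size_cat size_nseq /=; lia.
have -> : \sum_(i < n | P i) pw (k i) = pw c * \sum_(i < n | P i) pw (size (q i)).
  rewrite big_distrr /=; apply: eq_bigr => i Pi; rewrite sq // -pwD subnKC //.
  by have [_] := hq _ Pi; lia.
rewrite -[leRHS]mulr1 ler_pM2l ?pw_gt0 //; apply: kraft_fam => i j Pi Pj pij.
have [Vi ki] := hq _ Pi; have [Vj kj] := hq _ Pj.
have e : sp (m i) = sp (m j).
  by case: (prefix_catP pij) => h; [|apply/esym]; apply: pfV h; rewrite /= ?Vi ?Vj.
have em : m i = m j by move: Vi; rewrite e Vj => -[].
apply: inj => //; move: pij; rewrite /q em prefix_catI.
move: ki kj; rewrite em; set a := (_ - _).-1; set b := (_ - _).-1 => ki kj.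
suff ab u v : prefix (nseq u true ++ [:: false]) (nseq v true ++ [:: false]) -> u = v.
  by move=> /ab; rewrite /a /b; lia.
by elim: u v => [|u IHu] [|v] //= /IHu ->.
Qed.

End Dyadic.

(** * The Kraft-Chaitin lemma *)

Section KraftChaitin.
Variable R : realType.
Local Notation pw := (pw R).
Local Notation binreal := (binreal R).

(** The weight of the requests of index below [j], where [val] tells which indices are
    requests. *)
Definition wsum (val : pred nat) (k : nat -> nat) j : R := \sum_(i < j | val i) pw (k i).

Section Basic.
Variables (val : pred nat) (k : nat -> nat).
Local Notation S := (wsum val k).

Lemma wsumS j : S j.+1 = S j + (if val j then pw (k j) else 0).
Proof.
by rewrite /wsum big_mkcond big_ord_recr /= -big_mkcond.
Qed.

Lemma wsum_ge0 j : 0 <= S j.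
Proof. by apply: sumr_ge0 => i _; rewrite ltW // pw_gt0. Qed.

Lemma wsum_mono i j : (i <= j)%N -> S i <= S j.
Proof.
move=> /subnK <-; elim: (j - i)%N => // d; rewrite addSn wsumS => h.
by case: ifP => _; [have := pw_gt0 R (k (d + i)%N); lra|rewrite addr0].
Qed.

(** At a precision [D] that no length exceeds, the weights are natural numbers and can be
    computed. *)
Lemma wsum_nat D j : (forall i, (i < j)%N -> (k i <= D)%N) ->
  (\sum_(i < j) val i * 2 ^ (D - k i))%N%:R * pw D = S j.
Proof.
move=> hD; rewrite natr_sum big_distrl /= /wsum [RHS]big_mkcond; apply: eq_bigr => i _.
case: (val i); last by rewrite mul0n mul0r.
by rewrite mul1n pw_sub // hD.
Qed.
End Basic.

(** An interval of length [2^-n] contains an aligned dyadic interval of half that length: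
    the first one that starts in it. *)
Lemma dyadic_in (a : R) n : 0 <= a -> a + pw n <= 1 ->
  exists p, [/\ size p = n.+1, a <= binreal p & binreal p + pw (size p) <= a + pw n].
Proof.
move=> a0 a1; have u0 := pw_gt0 R n.+1; have e := pwS2 R n.
have [v lv uv] : exists2 v : nat, a <= v%:R * pw n.+1 & v%:R * pw n.+1 < a + pw n.+1.
  have ex : exists v : nat, a <= v%:R * pw n.+1.
    exists (2 ^ n.+1)%N; rewrite mulrC pw_natM; apply: le_trans a1.
    by rewrite lerDl ltW // pw_gt0.
  case: (ex_minnP ex) => v hv min_v; exists v => //; rewrite ltNge; apply/negP => h.
  case: v hv min_v h => [|v] hv min_v; first by rewrite mul0r; lra.
  rewrite -natr1 mulrDl mul1r lerD2r => /min_v; by rewrite ltnn.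
have lt_v : (v < 2 ^ n.+1)%N.
  rewrite -(ltr_nat R) -(ltr_pM2l u0) pw_natM mulrC; lra.
by exists (bits n.+1 v); rewrite /binreal val_bits // size_bits; split=> //; lra.
Qed.

(** A program for the request [j] is any string of length [k j + 1] whose interval lies in
    the step from [wsum j] to [wsum j.+1]; different steps do not overlap, so the domain is
    prefix-free, and the extra bit guarantees that there is room for one.  The
    position of the program is part of the conclusion: [random_of_weakly_low] relies on
    programs of late requests having a prescribed prefix. *)
Lemma kraft_chaitin (x : cantor) (val : pred nat) (k o : nat -> nat) :
  cpt x 1 (fun v => val (nth 0 v 0)) -> cpt1 x k -> cpt1 x o ->
  (forall j, wsum val k j <= 1) ->
  exists2 M, prefix_free_machine_in x M &
  forall j, val j -> exists p, [/\ M p = Some (str_of_nat (o j)), size p = (k j).+1,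
    wsum val k j <= binreal p & binreal p + pw (size p) <= wsum val k j.+1].
Proof.
move=> test_valid ck co le1; set S := wsum val k in le1 *.
pose inside a j := S j <= binreal (str_of_nat a) /\ binreal (str_of_nat a) + pw (szn a) <= S
  j.+1.
pose G a b := exists j, [&& val j, szn a == (k j).+1, o j == b & `[< inside a j >]].
have uniqG s t j j' : prefix s t -> inside (nat_of_str s) j -> inside (nat_of_str t) j' -> j
  = j'.
  rewrite /inside !nat_of_strK /szn !nat_of_strK => /(binreal_prefix R)[h1 h2] [h3 h4] [h5 h6].
  have t0 := pw_gt0 R (size t); have s0 := pw_gt0 R (size s).
  case: (ltngtP j j') => // h.
    by exfalso; have := wsum_mono val k h; rewrite -/S; lra.
  by exfalso; have := wsum_mono val k h; rewrite -/S; lra.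
have fG a b b' : G a b -> G a b' -> b = b'.
  move=> [j /and4P[_ _ /eqP <- /asboolP h]] [j' /and4P[_ _ /eqP <- /asboolP h']].
  by rewrite (@uniqG (str_of_nat a) (str_of_nat a) j j') ?str_of_natK ?prefix_refl.
exists (machine_of G); first split.
- apply: machine_of_computable => //.
  pose ks j := (\sum_(i < j.+1) k i)%N.
  have cks : cpt1 x ks.
    apply: (@cpt_sum x 1 (fun i _ => k i) (fun v => (nth 0 v 0).+1)); last cpt_auto.
    by apply: cpt_app1 ck _; cpt_auto.
  have le_ks i j : (i < j.+1)%N -> (k i <= ks j)%N.
    by move=> lt_ij; rewrite /ks (bigD1 (Ordinal lt_ij)) //= leq_addr.
  pose A j D := (\sum_(i < j) val i * 2 ^ (D - k i))%N.
  have cA : cpt2 x A.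
    apply: (@cpt_sum x 2 (fun i v => val i * 2 ^ (nth 0 v 1 - k i))%N (fun v => nth 0 v 0));
      last cpt_auto.
    apply: cpt_muln.
      by apply: (cpt_app1 (f := val)) test_valid _; cpt_auto.
    apply: cpt_expn; first cpt_auto.
    apply: cpt_subn; first cpt_auto.
    by apply: cpt_app1 ck _; cpt_auto.
  (* The precision [D] turns all quantities in [inside a j] into natural numbers. *)
  have ein a j (D := (szn a + ks j)%N) : `[< inside a j >] =
    ((A j D <= valn a * 2 ^ (D - szn a)) && ((valn a).+1 * 2 ^ (D - szn a) <= A j.+1 D))%N.
    have aD : (szn a <= D)%N by exact: leq_addr.
    have hD i : (i < j.+1)%N -> (k i <= D)%N.
      by move=> /le_ks/leq_trans; apply; exact: leq_addl.
    have D0 := pw_gt0 R D.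
    have eA i : (i <= j.+1)%N -> (A i D)%:R * pw D = S i.
      by move=> le_ij; apply: wsum_nat => i' lt_i'; apply: hD; exact: leq_trans le_ij.
    have le_scaled m n : (m <= n)%N = (m%:R * pw D <= n%:R * pw D) by rewrite ler_pM2r //
      ler_nat.
    rewrite !le_scaled !eA // !natrM -!mulrA (pw_sub R aD).
    by apply/asboolP/andP; rewrite /inside binreal_top.
  pose Q u := [&& val (nth 0 u 0),
    szn (nth 0 u 1) == (k (nth 0 u 0)).+1, o (nth 0 u 0) == nth 0 u 2 &
    let D := (szn (nth 0 u 1) + ks (nth 0 u 0))%N in
    (A (nth 0 u 0) D <= valn (nth 0 u 1) * 2 ^ (D - szn (nth 0 u 1))) &&
    ((valn (nth 0 u 1)).+1 * 2 ^ (D - szn (nth 0 u 1)) <= A (nth 0 u 0).+1 D)]%N.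
  apply: eq_re (_ : re x 2 (fun v => exists j, Q (j :: v))).
    by move=> v _; split=> -[j]; move=> h; exists j; move: h; rewrite ein.
  apply: (@re_ex x 2 Q); apply: re_dec.
  have cD : cpt x 3 (fun u => szn (nth 0 u 1) + ks (nth 0 u 0))%N.
    by apply: cpt_addn; [cpt_auto|apply: cpt_app1 cks _; cpt_auto].
  apply: cpt_and; first by apply: (cpt_app1 (f := val)) test_valid _; cpt_auto.
  apply: cpt_and; first by have := cpt_app1 ck (cpt_nth x 3 0); cpt_auto.
  apply: cpt_and; first by have := cpt_app1 co (cpt_nth x 3 0); cpt_auto.
  apply: cpt_and; apply: cpt_leq.
  - by apply: cpt_app2 cA _ cD; cpt_auto.
  - by cpt_auto.
  - by cpt_auto.
  - by apply: cpt_app2 cA _ cD; cpt_auto.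
- move=> s t /= /machine_of_dom[b [j /and4P[_ /eqP es _ /asboolP hs]]].
  move=> /machine_of_dom[b' [j' /and4P[_ /eqP et _ /asboolP ht]]] pst.
  have ej := uniqG _ _ _ _ pst hs ht; move: es et; rewrite /szn !nat_of_strK ej => <- est.
  by move: pst; rewrite prefixE -est take_size => /eqP.
move=> j vj; have := le1 j.+1; rewrite /S wsumS vj -/S => h.
have [p [sp lp up]] := dyadic_in (wsum_ge0 val k j) h.
exists p; split=> //.
apply/machine_ofP => //; exists j; rewrite vj /szn nat_of_strK sp str_of_natK !eqxx /=.
by apply/asboolP; rewrite /inside nat_of_strK /S wsumS vj /szn nat_of_strK.
Qed.

End KraftChaitin.

(** * Suprema of weights and binary expansions *)

Section Limits.
Variable R : realType.
Local Notation pw := (pw R).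
Local Notation binreal := (binreal R).
Local Notation wsum := (wsum R).
Implicit Types (val : pred nat) (k : nat -> nat).

Definition wsum_sup val k (a : R) :=
  (forall j, wsum val k j <= a) /\ (forall b, b < a -> exists j, b < wsum val k j).

Lemma wsum_sup_exists val k B : (forall j, wsum val k j <= B) ->
  exists2 a, wsum_sup val k a & a <= B.
Proof.
move=> hB; pose A : set R := range (wsum val k).
have A0 : A !=set0 by exists (wsum val k 0); exists 0%N.
have ubA : ubound A B by move=> _ [j _ <-].
have sA : has_sup A by split=> //; exists B.
exists (sup A); last by apply: ge_sup => //.
split=> [j|b lt_b]; first by apply: ub_le_sup; [exists B|exists j].
have [|_ [j _ <-] h] := sup_adherent (_ : 0 < sup A - b) sA; first by rewrite subr_gt0.
by exists j; apply: le_lt_trans h; lra.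
Qed.

Lemma wsum_sup_esum val k a : wsum_sup val k a ->
  \esum_(i in [set i | val i]) (pw (k i))%:E = a%:E.
Proof.
move=> [ub lub]; have ge0 n : val n -> (0 <= (pw (k n))%:E)%E.
  by rewrite lee_fin ltW // pw_gt0.
rewrite -nneseries_esum //.
have partial n : (\sum_(0 <= i < n | val i) (pw (k i))%:E = (wsum val k n)%:E)%E.
  by rewrite sumEFin big_mkord.
set L := limn _; have Ln n : ((wsum val k n)%:E <= L)%E.
  by rewrite -partial; apply: nneseries_lim_ge => i _; exact: ge0.
have : (L <= a%:E)%E.
  apply: lime_le; first by apply: is_cvg_nneseries_cond => i _; exact: ge0.
  by apply: nearW => n; rewrite partial lee_fin.
have : (0 <= L)%E by apply: le_trans (Ln 0%N); rewrite lee_fin wsum_ge0.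
case: L Ln => [l| |] // Ln _; rewrite lee_fin => la.
congr EFin; apply/eqP; rewrite eq_le la leNgt; apply/negP => /lub[j].
by have := Ln j; rewrite lee_fin leNgt => /negP.
Qed.

Lemma tail_wsum n j : wsum (fun i => n < i)%N id (n.+1 + j) = pw n - pw (n + j).
Proof.
elim: j => [|j IHj].
  rewrite !addn0 subrr /wsum big1 // => i; have := ltn_ord i.
  by rewrite ltnS leqNgt => /negbTE ->.
by rewrite addnS wsumS IHj addnS addSn ltnS leq_addr (pwS2 _ (n + j)); lra.
Qed.

Lemma pw_small e : 0 < e -> exists n, pw n < e.
Proof.
move=> e0; have [n hn] : exists n : nat, e^-1 < n%:R.
  by exists (Num.trunc e^-1).+1; exact: truncnS_gt.
exists n; rewrite /pw exprVn -[e]invrK ltf_pV2 ?posrE ?exprn_gt0 ?invr_gt0 //.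
by apply: lt_trans hn _; rewrite -natrX ltr_nat; exact: ltn_expl.
Qed.

(** The identity that trades a weight [2^-n] for a sum over all lengths above [n], and so
    spares the enumeration of requests from revising earlier values of [K]. *)
Lemma tail_wsum_sup n : wsum_sup (fun i => n < i)%N id (pw n).
Proof.
split=> [j|b lt_b].
  apply: le_trans (wsum_mono _ _ _ (leq_addl n.+1 j)) _; rewrite tail_wsum.
  by have := pw_gt0 R (n + j); lra.
have [|j hj] := pw_small (_ : 0 < pw n - b); first by lra.
exists (n.+1 + j)%N; rewrite tail_wsum.
have : pw (n + j) <= pw j by rewrite le_pw leq_addl.
lra.
Qed.

Lemma pow2N_esum M s : (pow2N R (K M s))%:E =
  \esum_(k in [set k | exists2 t, M t = Some s & (size t < k)%N]) (pw k)%:E.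
Proof.
have [[n -> [[t e st] min_n]]|[-> h]] := K_cases M s; last first.
  by rewrite esum1 // => k [t /h].
have -> : [set k | exists2 t, M t = Some s & (size t < k)%N] = [set k | (n < k)%N].
  apply/seteqP; split=> k /=; first by move=> [t' /min_n]; exact: leq_ltn_trans.
  by move=> lt_nk; exists t => //; rewrite st.
rewrite (wsum_sup_esum (tail_wsum_sup n)) /pow2N /pw; congr EFin.
by rewrite exprVn exprnN.
Qed.

Lemma expansion_wsum (y : cantor) n : wsum y S n = binreal (mkseq y n).
Proof.
elim: n => [|n IHn]; first by rewrite /wsum big_ord0 /binreal mul0r.
rewrite wsumS IHn /binreal !size_mkseq.
have -> : mkseq y n.+1 = rcons (mkseq y n) (y n).
  by rewrite /mkseq -addn1 iotaD map_cat cats1.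
rewrite val_rcons -muln2 natrD natrM mulrDl (pwS R n).
by case: (y n); rewrite ?mul0r ?mul1r /=; lra.
Qed.

(** An expansion is a family of requests of its own: the ones of length [i + 1] for the
    positions [i] of a bit [1].  The results on [wsum] thus apply to it. *)
Lemma binary_expansion_esum (y : cantor) (r : \bar R) : binary_expansion y r <->
  r = \esum_(i in [set i | y i]) (pw i.+1)%:E.
Proof.
rewrite /binary_expansion -nneseries_esum; last by move=> n _; rewrite lee_fin ltW // pw_gt0.
rewrite [X in _ <-> r = X]eseries_mkcond; set A := limn _; set B := limn _.
suff -> : A = B by [].
rewrite /A /B; congr (limn _); apply: funext => n; apply: eq_bigr => i _.
by case: (y i); rewrite ?mul0r ?mul1r // /pw exprVn.
Qed.

Lemma expansion_le (y : cantor) n j : binreal (mkseq y j) <= binreal (mkseq y n) + pw n.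
Proof.
have [le_jn|/ltnW le_nj] := leqP j n.
  have := wsum_mono R y S le_jn; rewrite !expansion_wsum; have := pw_gt0 R n; lra.
have [] := @binreal_prefix R (mkseq y n) (mkseq y j).
  by rewrite prefixE size_mkseq /mkseq -map_take take_iota (minn_idPl le_nj).
by rewrite !size_mkseq; have := pw_gt0 R j; lra.
Qed.

Lemma expansion_bounds (y : cantor) (a : R) : binary_expansion y a%:E ->
  forall n, binreal (mkseq y n) <= a <= binreal (mkseq y n) + pw n.
Proof.
move=> /binary_expansion_esum e n.
have [j|b wb leb] := @wsum_sup_exists y S (binreal (mkseq y n) + pw n).
  by rewrite expansion_wsum; exact: expansion_le.
move: e; rewrite (wsum_sup_esum wb) => -[->]; rewrite leb andbT -expansion_wsum.
by case: wb.
Qed.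

(** Of the two expansions of a dyadic rational this is the one that ends in ones: the
    strict inequality on the left makes the partial sums exceed [0.w] at some stage. *)
Lemma expansion_exists (a : R) : 0 < a -> a <= 1 ->
  exists2 y : cantor, binary_expansion y a%:E &
    forall n, binreal (mkseq y n) < a /\ a <= binreal (mkseq y n) + pw n.
Proof.
move=> a0 a1.
have /choice[v hv] : forall n, exists v : nat, v%:R * pw n < a /\ a <= v.+1%:R * pw n.
  move=> n; have ex : exists v : nat, a <= v.+1%:R * pw n.
    exists (2 ^ n)%N; rewrite -natr1 mulrDl mulrC pw_natM mul1r.
    by have := pw_gt0 R n; lra.
  case: (ex_minnP ex) => v h min_v; exists v; split=> //.
  case: v h min_v => [|v] h min_v; first by rewrite mul0r.
  by rewrite ltNge; apply/negP => /min_v; rewrite ltnn.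
have vS n : v n.+1 = ((v n).*2 + odd (v n.+1))%N.
  have [h1 h2] := hv n; have [h3 h4] := hv n.+1.
  have u0 := pw_gt0 R n.+1; move: h1 h2; rewrite (pwS2 R n) => h1 h2.
  have : ((v n).*2 < (v n.+1).+1)%N.
    rewrite -(ltr_nat R) -(ltr_pM2r u0) -muln2 natrM; lra.
  have : (v n.+1 < (v n).+1.*2)%N.
    rewrite -(ltr_nat R) -(ltr_pM2r u0) -muln2 natrM; lra.
  by have := odd_double_half (v n.+1); case: (odd _); lia.
pose y : cantor := fun n => odd (v n.+1).
have vE n : val_str (mkseq y n) = v n.
  elim: n => [|n IHn].
    have [h1 h2] := hv 0%N; case: (v 0%N) h1 => // m; rewrite /pw expr0 mulr1 -natr1.
    by move=> h1; exfalso; have m0 := ler0n R m; lra.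
  rewrite /mkseq -addn1 iotaD map_cat cats1 val_rcons -/(mkseq y n) IHn addn1 [RHS]vS.
  by [].
have rvE n : binreal (mkseq y n) = (v n)%:R * pw n by rewrite /binreal vE size_mkseq.
have yb n : binreal (mkseq y n) < a /\ a <= binreal (mkseq y n) + pw n.
  by have [h1 h2] := hv n; rewrite rvE; split=> //; move: h2; rewrite -natr1 mulrDl mul1r.
exists y => //; apply/binary_expansion_esum; rewrite (@wsum_sup_esum y S a) //; split.
  by move=> j; rewrite expansion_wsum ltW //; case: (yb j).
move=> b lt_b; have [|n hn] := pw_small (_ : 0 < a - b); first by lra.
by exists n; rewrite expansion_wsum; have [] := yb n; lra.
Qed.

End Limits.

(** * The requests whose total weight is [fK] *)

(** An index is read as [pair (pair k s) t]: the request is [(k, s)], and [t] witnesses it. *)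
Definition req_len i := unpair1 (unpair1 i).
Definition req_out i := str_of_nat (unpair2 (unpair1 i)).

Definition requests (x : cantor) (U : pfun_str) (val : pred nat) := [/\
  cpt x 1 (fun v => val (nth 0%N v 0)),
  forall i, val i -> leL (req_out i) x /\ exists2 t, U t = Some (req_out i) & (size t <
    req_len i)%N,
  forall s t k, leL s x -> U t = Some s -> (size t < k)%N ->
    exists i, [/\ val i, req_len i = k & req_out i = s] &
  forall i j, val i -> val j -> req_len i = req_len j -> req_out i = req_out j -> i = j].

Lemma key_inj i j : req_len i = req_len j -> req_out i = req_out j -> unpair1 i = unpair1 j.
Proof.
move=> e1 /(congr1 nat_of_str); rewrite !str_of_natK => e2.
by rewrite -(pairK (unpair1 i)) -(pairK (unpair1 j)) -/(req_len i) -/(req_len j) e1 e2.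
Qed.

Lemma requests_exist x U : computable_in x U -> exists val, requests x U val.
Proof.
move=> /re_graph rU.
pose P (c a : nat) := leL (str_of_nat (unpair2 a)) x /\
  exists r, graph U r (unpair2 a) /\ (szn r < unpair1 a)%N.
have rP : re x 2 (fun v => P (nth 0%N v 0) (nth 0%N v 1)).
  apply: re_and.
    apply: eq_re (re_dec (P := fun v => `[< leL (str_of_nat (unpair2 (nth 0%N v 1))) x >]) _).
      by move=> v _; split=> /asboolP.
    by apply: cpt_leL; cpt_auto.
  pose Q u := graph U (nth 0%N u 0) (unpair2 (nth 0%N u 2)) /\ (szn (nth 0%N u 0) < unpair1
    (nth 0%N u 2))%N.
  apply: eq_re (@re_ex x 2 Q _) => //.
  apply: re_and; last by apply: re_dec; cpt_auto.
  apply: eq_re (re_comp rU (n := 3) (W := fun u => [:: nth 0%N u 0; unpair2 (nth 0%N u 2)])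
    _) => //.
  by do 2!(apply: cpt_seq_cons; first cpt_auto); exact: cpt_seq_nil.
have [val test_valid [valP val_uniq]] := re_enum rP; exists (val 0%N); split.
- by apply: (cpt_app2 (f := fun c i => nat_of_bool (val c i))) test_valid _ _; cpt_auto.
- move=> i vi; have [|hL [r [hr lt_r]]] := (valP 0%N (unpair1 i)).2; first by exists i.
  by split=> //; exists (str_of_nat r).
- move=> s t k hL Us lt_k; have [|i vi e] := (valP 0%N (pair k (nat_of_str s))).1.
    rewrite /P unpair1_pair unpair2_pair nat_of_strK; split=> //.
    by exists (nat_of_str t); rewrite /graph /szn !nat_of_strK.
  by exists i; rewrite /req_len /req_out e unpair1_pair unpair2_pair nat_of_strK.
- by move=> i j vi vj e1 e2; apply: (val_uniq 0%N) => //; exact: key_inj.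
Qed.

Section Value.
Variables (R : realType) (x : cantor) (U : pfun_str) (val : pred nat).
Hypothesis rq : requests x U val.

Lemma requests_le1 : prefix_free [set s | U s <> None] -> forall j, wsum R val req_len j <= 1.
Proof.
move=> pfU j; have [_ h _ inj] := rq.
rewrite -[1]/(pw R 0); apply: (@kraft_requests R U 0 j val req_len req_out) => // i vi.
by have [_ [t Ut lt_t]] := h i vi; exists t => //; rewrite addn0.
Qed.

Lemma fK_wsum_sup a : wsum_sup val req_len a -> fK R U x = a%:E.
Proof.
have [_ h1 h2 inj] := rq => /wsum_sup_esum <-; rewrite /fK.
under eq_esum => s _ do rewrite pow2N_esum.
rewrite esum_esum; last by move=> s k _ _; rewrite lee_fin ltW // pw_gt0.
rewrite (@reindex_esum R nat (str * nat)%type [set i | val i] _ (fun i => (req_out i, req_len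
  i))) //.
split.
- by move=> i /= vi; have [hL ht] := h1 i vi; split.
- by move=> i j /set_mem vi /set_mem vj /= [e1 e2]; exact: inj.
- move=> [s k] [/= hL [t Ut lt_k]]; have [i [vi e1 e2]] := h2 s t k hL Ut lt_k.
  by exists i => //; rewrite e1 e2.
Qed.

End Value.

(** The machine of the requests [(n + 1, n)], of total weight [1], outputs every string. *)
Lemma optimal_total (R : realType) x U s : optimal_in x U -> exists t, U t = Some s.
Proof.
move=> [_ optU].
have le1 j : wsum R xpredT S j <= 1.
  suff -> : wsum R xpredT S j = 1 - pw R j by have := pw_gt0 R j; lra.
  elim: j => [|j IHj]; first by rewrite /wsum big_ord0 /pw expr0 subrr.
  by rewrite wsumS IHj (pwS2 R j); lra.
have [||||M hM hs] := @kraft_chaitin R x xpredT S id; try by [].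
- exact: (cpt_const x 1 1).
- by rewrite /cpt1; cpt_auto.
- by rewrite /cpt1; cpt_auto.
have [c hc] := optU M hM; have [p [Mp _ _ _]] := hs (nat_of_str s) isT.
rewrite nat_of_strK in Mp; have := hc s.
have [[k _ [[t Ut _] _]]|[-> _]] := K_cases U s; first by exists t.
by have [[k -> _]|[_ h]] := K_cases M s; [|case: (h p)].
Qed.

(** * From weak lowness to randomness *)

Lemma optimal_program x V M : optimal_in x V -> prefix_free_machine_in x M ->
  exists c, forall s t, M t = Some s ->
    exists2 t', V t' = Some s & (size t' <= size t + c)%N.
Proof.
move=> [_ optV] /optV[c hc]; exists c => s t Mt; apply/K_le.
apply: le_trans (hc s) _; rewrite PoszD EFinD leeD2r //.
by apply/K_le; exists t.
Qed.

Lemma bits0_inj : injective (bits^~ 0%N).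
Proof. by move=> m n /(congr1 size); rewrite !size_bits. Qed.

(** [bits n 0] is the string [0^n].  These strings translate statements about all numbers
    into statements about strings on the left of [x], the only ones that [fK] sees. *)
Lemma leL_bits0 n x : leL (bits n 0) x.
Proof. by apply/leL_val; rewrite val_bits // expn_gt0. Qed.

Lemma zeros_program x U : optimal_in x U -> exists c, forall n t, U t = Some (str_of_nat n) ->
  exists2 t', U t' = Some (bits n 0) & (size t' <= size t + c)%N.
Proof.
move=> optU; have [[cU pfU] _] := optU.
pose G a b := exists n, graph U a n /\ b = bitsn n 0.
have fG a b b' : G a b -> G a b' -> b = b'.
  move=> [n [h ->]] [n' [h' ->]]; congr bitsn.
  by move: h; rewrite /graph h' => -[/(congr1 nat_of_str)]; rewrite !str_of_natK.
have [|c hc] := optimal_program (M := machine_of G) optU.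
  split; last first.
    move=> s t /machine_of_dom[b [n [hs _]]] /machine_of_dom[b' [n' [ht _]]]; apply: pfU.
      by move: hs; rewrite /graph nat_of_strK /= => ->.
    by move: ht; rewrite /graph nat_of_strK /= => ->.
  apply: machine_of_computable => //.
  pose Q u := graph U (nth 0%N u 1) (nth 0%N u 0) /\ nth 0%N u 2 = bitsn (nth 0%N u 0) 0.
  apply: eq_re (@re_ex x 2 Q _) => //; apply: re_and.
    apply: eq_re (re_comp (re_graph cU) (n := 3) (W := fun u => [:: nth 0%N u 1; nth 0%N u
      0]) _) => //.
    by do 2!(apply: cpt_seq_cons; first cpt_auto); exact: cpt_seq_nil.
  apply: eq_re (re_dec (P := fun u => nth 0%N u 2 == bitsn (nth 0%N u 0) 0) _).
    by move=> v _; split=> /eqP.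
  by cpt_auto.
exists c => n t Ut; apply: hc; apply/machine_ofP => //.
by exists n; rewrite /graph nat_of_strK.
Qed.

(** The machine reads a program [s] of [V] and lets [N] run on [V s] followed by the rest
    of the input.  It outputs [n] when [N] outputs [0^n]. *)
Lemma relay_machine x V N : prefix_free_machine_in x V -> prefix_free_machine_in x N ->
  exists2 M, prefix_free_machine_in x M &
  forall s w p n, V s = Some w -> N (w ++ p) = Some (bits n 0) -> M (s ++ p) = Some
    (str_of_nat n).
Proof.
move=> [cV pfV] [cN pfN].
pose G a b := exists s p w, graph V s w /\ graph N (catn w p) (bitsn b 0) /\ a = catn s p.
have GP s b : G (nat_of_str s) b -> exists u p w, [/\ V u = Some w, N (w ++ p) = Some (bits b
  0) & s = u ++ p].
  move=> [u [p [w [hV [hN /(congr1 str_of_nat)]]]]]; rewrite /catn !nat_of_strK => ->.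
  exists (str_of_nat u), (str_of_nat p), (str_of_nat w); split=> //.
  by move: hN; rewrite /graph /catn /bitsn !nat_of_strK.
have pG s t b b' : G (nat_of_str s) b -> G (nat_of_str t) b' -> prefix s t -> s = t /\ b = b'.
  move=> /GP[u [p [w [Vu Np ->]]]] /GP[u' [p' [w' [Vu' Np' ->]]]] pst.
  have e : u = u'.
    by case: (prefix_catP pst) => h; [|apply/esym]; apply: pfV h; rewrite /= ?Vu ?Vu'.
  move: Vu pst; rewrite e Vu' prefix_catI => -[ew] pp'.
  have : w ++ p = w ++ p' by apply: pfN; rewrite /= ?Np -?ew ?Np' // prefix_catI.
  move=> ep; move: Np; rewrite -ew in ep *; rewrite ep Np' => -[/bits0_inj ->]; split=> //.
  by move/eqP: ep; rewrite eqseq_cat // eqxx => /eqP ->.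
have fG a b b' : G a b -> G a b' -> b = b'.
  rewrite -(str_of_natK a) => h h'; by have [] := pG _ _ _ _ h h' (prefix_refl _).
exists (machine_of G).
  split; last by move=> s t /machine_of_dom[b hs] /machine_of_dom[b' ht] /(pG _ _ _ _ hs ht)[].
  apply: machine_of_computable => //.
  pose Q u := graph V (nth 0%N u 2) (nth 0%N u 0) /\
    graph N (catn (nth 0%N u 0) (nth 0%N u 1)) (bitsn (nth 0%N u 4) 0) /\
    nth 0%N u 3 = catn (nth 0%N u 2) (nth 0%N u 1).
  apply: eq_re (@re_ex x 2 (fun v => exists p w, Q [:: w, p & v]) _) => //.
  apply: eq_re (@re_ex x 3 (fun v => exists w, Q (w :: v)) _) => //.
  apply: eq_re (@re_ex x 4 Q _) => //; apply: re_and.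
    apply: eq_re (re_comp (re_graph cV) (n := 5) (W := fun u => [:: nth 0%N u 2; nth 0%N u
      0]) _) => //.
    by do 2!(apply: cpt_seq_cons; first cpt_auto); exact: cpt_seq_nil.
  apply: re_and.
    apply: eq_re (re_comp (re_graph cN) (n := 5) (W := fun u =>
      [:: catn (nth 0%N u 0) (nth 0%N u 1); bitsn (nth 0%N u 4) 0]) _) => //.
    by do 2!(apply: cpt_seq_cons; first cpt_auto); exact: cpt_seq_nil.
  apply: eq_re (re_dec (P := fun u => nth 0%N u 3 == catn (nth 0%N u 2) (nth 0%N u 1)) _).
    by move=> v _; split=> /eqP.
  by cpt_auto.
move=> s w p n Vs Np; apply/machine_ofP => //.
exists (nat_of_str s), (nat_of_str p), (nat_of_str w).
by rewrite /graph /catn /bitsn !nat_of_strK str_of_natK.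
Qed.

(** If [size s + C < m], where [V s] is the prefix [w] of length [m] of the expansion, then
    every request beyond stage [j0] has a program [w ++ q] of [N], and [s ++ q] is shorter
    than it by more than [C]. *)
Lemma random_of_weakly_low (R : realType) (U : pfun_str) (hU : optimal U)
    (x : cantor) (V : pfun_str) (hV : optimal_in x V) :
  weakly_low_for_K U V -> random_real_for V (fK R U x).
Proof.
move=> [c wl]; have [[cU0 pfU] _] := hU; have cU := computable_oracle x cU0.
have [val rq] := requests_exist cU; have le1 := requests_le1 R rq pfU.
have [test_valid rqP rqE rqI] := rq.
have [a wa a1] := wsum_sup_exists le1; rewrite (fK_wsum_sup rq wa).
have [ub lub] := wa.
have a0 : 0 < a.
  have [t Ut] := optimal_total R [::] hU.
  have [i [vi _ _]] := rqE [::] t (size t).+1 (or_intror erefl) Ut (ltnSn _).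
  have := ub i.+1; have := wsum_ge0 R val req_len i; have := pw_gt0 R (req_len i).
  by rewrite wsumS vi; lra.
have [y exp_y y_bounds] := expansion_exists a0 a1.
exists y; split=> //; apply: contrapT => nrandom.
have compress C : exists n t, V t = Some (mkseq y n) /\ (size t + C < n)%N.
  apply: contrapT => h; apply: nrandom; exists C => n.
  have [[k -> [[t Vt st] _]]|[-> _]] := K_cases V (mkseq y n); last by rewrite leey.
  rewrite lee_fin lerBlDr -PoszD lez_nat leqNgt; apply/negP => lt_n.
  by apply: h; exists n, t; rewrite st.
have ck : cpt1 x req_len by rewrite /cpt1 /req_len; cpt_auto.
have co : cpt1 x (fun i => unpair2 (unpair1 i)) by rewrite /cpt1; cpt_auto.
have [N hN NP] := kraft_chaitin test_valid ck co le1.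
have [M hM MP] := relay_machine hV.1 hN.
have [c1 zero_prog] := zeros_program hU.
have [c2 optV] := optimal_program hV hM.
(* [c1] and [c2] are lost in passing from [n] to [0^n] and from [M] to [V], and two bits
   in passing from [K U] to a request to a program of [N]. *)
have [m [s [Vs lt_m]]] := compress (c + c1 + c2 + 2)%N.
have [lo_m hi_m] := y_bounds m.
(* After stage [j0] the approximation lies between [0.w] and [a]. *)
have [j0 hj0] := lub _ lo_m.
apply: wl; apply: (sub_finite_set (B := [set` [seq size (req_out i) | i <- iota 0 j0]])) =>
  [n /= le_n|]; last first.
  exact: finite_seq.
have [[k eK [[t Ut st] _]]|[_ h]] := K_cases U (str_of_nat n); last first.
  by have [t /h] := optimal_total R (str_of_nat n) hU.
have [t' Ut' le_t'] := zero_prog _ _ Ut.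
have [i [vi ki oi]] := rqE _ _ (size t').+1 (leL_bits0 n x) Ut' (ltnSn _).
have [lt_i|le_i] := ltnP i j0.
  by apply/mapP; exists i; rewrite ?mem_iota // oi size_bits.
exfalso; have [p [Np sp lo_p hi_p]] := NP i vi.
have /prefixP[q ep] : prefix (mkseq y m) p.
  apply: (@prefix_binreal R); rewrite ?size_mkseq.
    by have := wsum_mono R val req_len le_i; lra.
  by have := ub i.+1; lra.
have Mq : M (s ++ q) = Some (str_of_nat n).
  by apply: MP Vs _; rewrite -ep Np -oi.
have [t'' Vt'' le_t''] := optV _ _ Mq.
have : (K U (str_of_nat n) <= (size t'' + c)%:Z%:E)%E.
  apply: le_trans le_n _; rewrite PoszD EFinD leeD2r //.
  by apply/K_le; exists t''.
rewrite eK lee_fin lez_nat => le_k.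
move: sp le_t''; rewrite ep !size_cat size_mkseq ki => sp le_t''.
by lia.
Qed.

(** * From randomness to weak lowness *)

Section Sums.
Variable R : realType.

Lemma ler_sum_subset (T : eqType) (s s' : seq T) (F : T -> R) :
  uniq s -> uniq s' -> {subset s <= s'} -> (forall i, 0 <= F i) ->
  \sum_(i <- s) F i <= \sum_(i <- s') F i.
Proof.
move=> us us' sub F0; rewrite [leRHS](bigID (mem s)) /= -[leLHS]addr0.
apply: lerD; last by apply: sumr_ge0.
rewrite -[leRHS]big_filter (perm_big [seq i <- s' | i \in s]) //.
apply: uniq_perm; rewrite ?filter_uniq // => i; rewrite mem_filter.
by have [/sub ->|] := boolP (i \in s).
Qed.

Lemma ler_sum_inj (P Q : pred nat) (F G : nat -> R) (J : nat -> nat) n n' :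
  (forall i, (i < n)%N -> P i -> [/\ (J i < n')%N, Q (J i) & F i <= G (J i)]) ->
  (forall i j, P i -> P j -> J i = J j -> i = j) -> (forall j, 0 <= G j) ->
  \sum_(i < n | P i) F i <= \sum_(j < n' | Q j) G j.
Proof.
move=> hJ inj G0.
rewrite -(big_mkord P F) -(big_mkord Q G) /index_iota !subn0.
apply: (@le_trans _ _ (\sum_(j <- map J [seq i <- iota 0 n | P i]) G j)).
  rewrite big_map big_filter big_seq_cond [leRHS]big_seq_cond; apply: ler_sum => i /andP[].
  by rewrite mem_iota => /= lt_i Pi; have [] := hJ i lt_i Pi.
rewrite -[leRHS]big_filter; apply: ler_sum_subset => //.
- rewrite map_inj_in_uniq ?filter_uniq ?iota_uniq // => i j; rewrite !mem_filter.
  by move=> /andP[Pi _] /andP[Pj _]; exact: inj.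
- by rewrite filter_uniq ?iota_uniq.
- move=> j /mapP[i]; rewrite !mem_filter !mem_iota => /andP[Pi lt_i] ->.
  by have [lt_J -> _] := hJ i lt_i Pi.
Qed.
End Sums.

(** In this section [val] and [k] are requests whose weights add up to [a], and [lev] and
    [k'] are the ones confirmed at some level. *)
Section Cover.
Variable R : realType.
Local Notation pw := (pw R).
Variables (val lev : pred nat) (k k' : nat -> nat).
Local Notation A := (wsum R val k).
Local Notation Gm := (wsum R lev k').

(** The interval of step [i] goes from [cover_start i] to [cover_end i.+1]: it leaves out
    the reals below the current approximation [A i], which are below [a]. *)
Fixpoint cover_end j : R := if j is i.+1
  then Num.max (cover_end i) (A i) + 2 * (if lev i then pw (k' i) else 0) else 0.

Definition cover_start j := Num.max (cover_end j) (A j).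

Lemma cover_end_lower s d : A s + 2 * (Gm (s + d).+1 - Gm s) <= cover_end (s + d).+1.
Proof.
elim: d => [|d IHd].
  rewrite addn0 wsumS /=; have : A s <= Num.max (cover_end s) (A s) by rewrite le_max lexx orbT.
  by case: (lev s); lra.
rewrite addnS [cover_end _]/= -/(cover_end (s + d).+1) [Gm (s + d).+2]wsumS.
have : cover_end (s + d).+1 <= Num.max (cover_end (s + d).+1) (A (s + d).+1) by rewrite
  le_max lexx.
move: IHd; set u := cover_end _; move: (Num.max _ _) => w.
by case: (lev (s + d).+1); lra.
Qed.

(** From stage [s] on, [cover_end] grows by at least twice the weight that gets confirmed,
    hence by at least twice the increase of [A].  Starting from at least [A s], it must pass
    [a], because [A t] comes closer to [a] than half of the distance at stage [s].  When it
    passes [a] it does so within an interval, as [A] never exceeds [a]. *)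
Lemma cover_hits a s : wsum_sup val k a -> A s < a ->
  (forall t, exists t', A t - A s <= Gm t' - Gm s) ->
  exists j, [/\ lev j, cover_start j <= a & a <= cover_start j + 2 * pw (k' j)].
Proof.
move=> [ub lub] lt_s sync.
(* At stage [t] more than half of what was missing at stage [s] has appeared. *)
have [|t ht] := lub ((A s + a) / 2); first by lra.
have [t' ht'] := sync t.
have ex : exists n, a < cover_end n.
  have lt_st' : (s < t')%N.
    rewrite ltnNge; apply/negP => /(wsum_mono R lev k'); lra.
  exists t'; have := cover_end_lower s (t' - s.+1); rewrite -addSn subnKC //; lra.
case: (ex_minnP ex) => -[|j] hj min_j.
  have := ub 0%N; rewrite /wsum big_ord0; move: hj => /=; lra.
have le_j : cover_end j <= a.
  by rewrite leNgt; apply/negP => /min_j; rewrite ltnn.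
exists j; have le_start : cover_start j <= a by rewrite ge_max le_j ub.
move: hj; rewrite /= -/cover_end -/(cover_start j); case: (lev j) => h.
  by split=> //; lra.
by exfalso; lra.
Qed.

(** [cover_end] in units of [2^-D]. *)
Definition cover_end_nat (D j : nat) : nat :=
  iteri j (fun i z => maxn z (\sum_(l < i) val l * 2 ^ (D - k l)) + 2 * (lev i * 2 ^ (D - k'
    i)))%N 0%N.

Definition cover_start_nat D j := maxn (cover_end_nat D j) (\sum_(l < j) val l * 2 ^ (D - k
  l))%N.

Lemma max_natM (m n : nat) (u : R) : 0 <= u ->
  (maxn m n)%:R * u = Num.max (m%:R * u) (n%:R * u).
Proof.
move=> u0; have [le_mn|/ltnW le_nm] := leqP m n.
  by rewrite max_r // ler_wpM2r // ler_nat.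
by rewrite max_l // ler_wpM2r // ler_nat.
Qed.

Lemma cover_start_natE D j : (forall i, (i < j)%N -> (k i <= D)%N /\ (k' i <= D)%N) ->
  (cover_start_nat D j)%:R * pw D = cover_start j.
Proof.
move=> hD; have D0 := pw_gt0 R D.
have eA i : (i <= j)%N -> (\sum_(l < i) val l * 2 ^ (D - k l))%N%:R * pw D = A i.
  by move=> le_ij; apply: wsum_nat => l lt_l; have [] := hD l (leq_trans lt_l le_ij).
have eC i : (i <= j)%N -> (cover_end_nat D i)%:R * pw D = cover_end i.
  elim: i => [|i IHi] lt_i; first by rewrite /= mul0r.
  rewrite [cover_end_nat _ _]/= -/(cover_end_nat D i) natrD mulrDl max_natM ?ltW // IHi; last
    exact: ltnW.
  rewrite eA ?(ltnW lt_i) //= !natrM -!mulrA; congr (_ + 2 * _).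
  case: (lev i); last by rewrite mul0r.
  by rewrite mul1r pw_sub //; have [] := hD i lt_i.
by rewrite /cover_start_nat max_natM ?ltW // eC // eA.
Qed.

End Cover.

(** An index [j] of [lev c] is read as [pair i t]: the request [i] is confirmed at level
    [c], with witness [t].  So [unpair1 j <= j] says that the confirmation does not precede
    the request. *)
Definition confirmations x (V : pfun_str) (val : pred nat) (lev : nat -> pred nat) := [/\
  cpt2 x lev,
  forall c j, lev c j -> val (unpair1 j) /\
    exists2 t, V t = Some (req_out (unpair1 j)) & (size t + c < req_len (unpair1 j))%N,
  forall c i t, val i -> V t = Some (req_out i) -> (size t + c < req_len i)%N ->
    exists2 j, lev c j & unpair1 j = i &
  forall c j j', lev c j -> lev c j' -> unpair1 j = unpair1 j' -> j = j'].

Lemma confirmations_exist x V (val : pred nat) : computable_in x V -> cpt x 1 (fun v => val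
  (nth 0%N v 0)) ->
  exists lev, confirmations x V val lev.
Proof.
move=> /re_graph rV test_valid.
pose P (c i : nat) := val i /\ exists r, graph V r (unpair2 (unpair1 i)) /\ (szn r + c <
  req_len i)%N.
have rP : re x 2 (fun v => P (nth 0%N v 0) (nth 0%N v 1)).
  apply: re_and.
    apply: (re_dec (P := fun v => val (nth 0%N v 1))).
    by apply: (cpt_app1 (f := val)) test_valid _; cpt_auto.
  pose Q u := graph V (nth 0%N u 0) (unpair2 (unpair1 (nth 0%N u 2))) /\
    (szn (nth 0%N u 0) + nth 0%N u 1 < unpair1 (unpair1 (nth 0%N u 2)))%N.
  apply: eq_re (@re_ex x 2 Q _) => //.
  apply: re_and; last by apply: re_dec; cpt_auto.
  apply: eq_re (re_comp rV (n := 3) (W := fun u => [:: nth 0%N u 0; unpair2 (unpair1 (nth 0%N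
    u 2))]) _) => //.
  by do 2!(apply: cpt_seq_cons; first cpt_auto); exact: cpt_seq_nil.
have [lev clev [levP lev_inj]] := re_enum rP; exists lev; split=> // [c j vj|c i t vi Vt lt_t].
  have [|vi [r [hr lt_r]]] := (levP c (unpair1 j)).2; first by exists j.
  by split=> //; exists (str_of_nat r).
apply/levP; split=> //; exists (nat_of_str t).
by rewrite /graph /szn nat_of_strK -/(req_out i).
Qed.

Lemma confirmed_weight_le (R : realType) x U V val lev c n : requests x U val ->
  prefix_free [set s | V s <> None] -> confirmations x V val lev ->
  wsum R (lev c) (req_len \o unpair1) n <= pw R c.
Proof.
move=> [_ _ _ inj] pfV [_ levP _ lev_inj].
apply: (@kraft_requests R V c n (lev c) (req_len \o unpair1) (req_out \o unpair1)) => // [j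
  /levP[_ //]|j j' lj lj' /= e1 e2].
apply: (lev_inj c) => //; apply: inj => //.
- by case: (levP c j lj).
- by case: (levP c j' lj').
Qed.

(** An unconfirmed request is for one of the finitely many strings [s] that violate
    [K U s > K V s + c], and is not longer than [K V s + c]; each pair of a string and a
    length is requested once. *)
Lemma late_confirmed x U V val lev c : requests x U val -> confirmations x V val lev ->
  (forall s, exists t, V t = Some s) ->
  finite_set [set n | (K U (str_of_nat n) <= K V (str_of_nat n) + c%:Z%:E)%E] ->
  exists s0, forall i, (s0 <= i)%N -> val i -> exists2 j, lev c j & unpair1 j = i.
Proof.
move=> [_ rqP _ rq_inj] [_ _ lev_ex _] totV /finite_seqP[B eB].
pose Q n i := [/\ val i, req_out i = str_of_nat n & ~ exists2 j, lev c j & unpair1 j = i].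
suff [s0 hs0] : exists s0, forall n i, n \in B -> Q n i -> (i < s0)%N.
  exists s0 => i le_i vi; apply: contrapT => nlev.
  have [_ [t Ut lt_t]] := rqP i vi.
  have [/hs0/(_ (And3 vi _ nlev))|nB] := boolP (nat_of_str (req_out i) \in B).
    by rewrite nat_of_strK => /(_ erefl); rewrite ltnNge le_i.
  apply: nlev; have : ~ (K U (req_out i) <= K V (req_out i) + c%:Z%:E)%E.
    move=> h; move/negP: nB; apply.
    have : [set n | (K U (str_of_nat n) <= K V (str_of_nat n) + c%:Z%:E)%E] (nat_of_str
      (req_out i)).
      by rewrite /= nat_of_strK.
    by rewrite eB.
  have [[k -> [[r Vr sr] _]]|[_ h]] := K_cases V (req_out i); last by have [r /h] := totV
    (req_out i).
  move=> h; apply: (lev_ex c i r) => //; rewrite sr; apply: leq_trans lt_t.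
  rewrite ltnS ltnW // ltnNge; apply/negP => le_t; apply: h.
  rewrite -EFinD -PoszD; apply/K_le; exists t => //.
elim: B {eB} => [|n B [s1 hs1]]; first by exists 0%N.
suff [s2 hs2] : exists s2, forall i, Q n i -> (i < s2)%N.
  exists (maxn s1 s2) => m i; rewrite inE leq_max => /orP[/eqP ->|mB] q.
    by rewrite hs2 ?orbT.
  by rewrite (hs1 m).
have [r Vr] := totV (str_of_nat n).
have hQ i : Q n i -> (req_len i <= size r + c)%N.
  move=> [vi oi nlev]; rewrite leqNgt; apply/negP => lt_r; apply: nlev.
  by apply: (lev_ex c i r); rewrite ?oi.
suff [s2 hs2] : exists s2, forall i, val i -> req_out i = str_of_nat n -> (req_len i < (size
  r + c).+1)%N -> (i < s2)%N.
  by exists s2 => i q; have [vi oi _] := q; apply: hs2 => //; rewrite ltnS; exact: hQ.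
elim: (size r + c).+1 => [|b [s2 hs2]]; first by exists 0%N.
have [[i [vi oi ki]]|none] := pselect (exists i, [/\ val i, req_out i = str_of_nat n &
  req_len i = b]).
  exists (maxn i.+1 s2) => i' vi' oi'; rewrite ltnS leq_eqVlt leq_max => /predU1P[ki'|lt_b].
    by rewrite (rq_inj i' i) ?ltnSn // ?oi' ?oi ?ki' ?ki.
  by rewrite hs2 ?orbT.
exists s2 => i' vi' oi'; rewrite ltnS leq_eqVlt => /predU1P[ki'|]; last exact: hs2.
by case: none; exists i'.
Qed.

(** A request of index [i >= s0] is confirmed at an index that is at least [i], and
    different requests are confirmed at different indices. *)
Lemma confirmed_catches_up (R : realType) x V (val : pred nat) lev c s0 :
  confirmations x V val lev ->
  (forall i, (s0 <= i)%N -> val i -> exists2 j, lev c j & unpair1 j = i) ->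
  forall t, exists t', wsum R val req_len t - wsum R val req_len s0 <=
    wsum R (lev c) (req_len \o unpair1) t' - wsum R (lev c) (req_len \o unpair1) s0.
Proof.
move=> [_ levP _ lev_inj] late t.
have tail (P : pred nat) (k : nat -> nat) n : (s0 <= n)%N ->
    wsum R P k n - wsum R P k s0 = \sum_(i < n | P i && (s0 <= i)%N) pw R (k i).
  move=> le_n; rewrite /wsum -!(big_mkord P (fun i => pw R (k i))).
  rewrite [X in X - _](big_cat_nat _ (n := s0)) //= addrAC subrr add0r.
  rewrite -(big_mkord (fun i => P i && (s0 <= i)%N) (fun i => pw R (k i))).
  rewrite [RHS](big_cat_nat _ (n := s0)) //=.
  rewrite [X in _ = X + _]big_nat_cond [X in _ = X + _]big_pred0; last first.
    by move=> i; case: (ltnP i s0) => h; rewrite ?andbF.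
  rewrite add0r big_nat_cond [RHS]big_nat_cond; apply: eq_bigl => i.
  by case: (leqP s0 i) => h; rewrite ?andbT ?andbF.
have [le_t|/ltnW le_t] := leqP s0 t; last first.
  by exists s0; rewrite subrr subr_le0; exact: wsum_mono.
have /choice[J hJ] : forall i, exists j, (s0 <= i)%N -> val i -> lev c j /\ unpair1 j = i.
  move=> i; have [le_i|_] := leqP s0 i; last by exists 0%N.
  have [vi|nvi] := boolP (val i); last by exists 0%N.
  by have [j lj pj] := late i le_i vi; exists j.
exists (maxn s0 (\max_(i < t) J i).+1).
rewrite !tail ?leq_maxl //.
apply: (@ler_sum_inj R (fun i => val i && (s0 <= i)%N) (fun j => lev c j && (s0 <= j)%N)
  (fun i => pw R (req_len i)) (fun j => pw R (req_len (unpair1 j))) J) => [i lt_i /andP[vi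
    le_i]|i i' /andP[vi le_i] /andP[vi' le_i']|j].
- have [lJ pJ] := hJ i le_i vi; split.
  + by rewrite leq_max ltnS (leq_bigmax (Ordinal lt_i)) orbT.
  + by rewrite lJ /= (leq_trans le_i) // -{1}pJ unpair1_le.
  + by rewrite /= pJ.
- have [_ e] := hJ i le_i vi; have [_ e'] := hJ i' le_i' vi'.
  by move=> eJ; rewrite -e -e' eJ.
- by rewrite ltW // pw_gt0.
Qed.

(** A request of the test has index [pair d j], where [d = 4 * e + u].  The cover of level
    [8 * e + 8] is used, lengths are reduced by [d], and [u] selects one of the four
    dyadic intervals that may contain [a].  The level exceeds [2 * d], so that the weights
    multiplied by [2^d] stay below [2^-(d+1)], which is summable. *)
Definition level d := (8 * (d %/ 4) + 8)%N.

Lemma level_ge d : (d + d.+1 <= level d)%N.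
Proof. by rewrite /level {1 2}(divn_eq d 4); have := ltn_pmod d (isT : (0 < 4)%N); lia. Qed.

Section CoverRequests.
Variables (R : realType) (x : cantor) (U V : pfun_str) (val : pred nat) (lev : nat -> pred nat).
Hypothesis (rq : requests x U val) (lv : confirmations x V val lev).
Hypothesis pfV : prefix_free [set s | V s <> None].

Local Notation k' := (req_len \o unpair1).

Definition test_valid r := lev (level (unpair1 r)) (unpair2 r).
Definition test_len r := (req_len (unpair1 (unpair2 r)) - unpair1 r)%N.
Definition test_prec j := (\sum_(i < j.+1) req_len i)%N.
Definition cover_floor c j :=
  (cover_start_nat val (lev c) req_len k' (test_prec j) j %/ 2 ^ (test_prec j - req_len
    (unpair1 j)))%N.
(** An interval of length [2 * 2^-k] can only meet the closed dyadic intervals of length [2^-k]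
    numbered from [q - 1] to [q + 2], where [q] is the number of the one in which it starts. *)
Definition test_out r :=
  bitsn (req_len (unpair1 (unpair2 r))) (cover_floor (level (unpair1 r)) (unpair2 r) +
    unpair1 r %% 4 - 1)%N.

Lemma req_len_le_prec i j : (i <= j)%N -> (req_len i <= test_prec j)%N.
Proof. by rewrite -ltnS => lt_ij; rewrite /test_prec (bigD1 (Ordinal lt_ij)) //= leq_addr. Qed.

Lemma cpt_req_len n F : cpt x n F -> cpt x n (fun v => req_len (F v)).
Proof. by rewrite /req_len => cF; cpt_auto. Qed.

Lemma cpt_level n F : cpt x n F -> cpt x n (fun v => level (F v)).
Proof. by rewrite /level => cF; cpt_auto. Qed.

Lemma cpt_lev n F G : cpt x n F -> cpt x n G -> cpt x n (fun v => lev (F v) (G v)).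
Proof. by case: lv => clev _ _ _; exact: (cpt_app2 (f := fun c j => nat_of_bool (lev c j)))
  clev. Qed.

Lemma cpt_test_valid : cpt x 1 (fun v => test_valid (nth 0%N v 0)).
Proof. by apply: cpt_lev; [apply: cpt_level|]; cpt_auto. Qed.

Lemma cpt_test_len : cpt1 x test_len.
Proof. by apply: cpt_subn; [apply: cpt_req_len|]; cpt_auto. Qed.

Lemma cpt_test_out : cpt1 x test_out.
Proof.
have [vcpt _ _ _] := rq.
have cval_ n F : cpt x n F -> cpt x n (fun v => val (F v)).
  exact: (cpt_app1 (f := fun i => nat_of_bool (val i))) vcpt.
have cprecc : cpt1 x test_prec.
  by apply: (@cpt_sum x 1 (fun i _ => req_len i) (fun v => (nth 0%N v 0).+1)); [apply:
    cpt_req_len|]; cpt_auto.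
pose As D j := (\sum_(l < j) val l * 2 ^ (D - req_len l))%N.
have cAs : cpt2 x As.
  apply: (@cpt_sum x 2 (fun l v => val l * 2 ^ (nth 0%N v 0 - req_len l))%N (fun v => nth 0%N
    v 1)); last cpt_auto.
  apply: cpt_muln; first by apply: cval_; cpt_auto.
  apply: cpt_expn; first cpt_auto.
  by apply: cpt_subn; [|apply: cpt_req_len]; cpt_auto.
pose C c D j := cover_end_nat val (lev c) req_len k' D j.
have cC : cpt3 x C.
  apply: (@cpt_iteri x 3 (fun=> 0%N) (fun i z v => maxn z (As (nth 0%N v 1) i) +
    2 * (lev (nth 0%N v 0) i * 2 ^ (nth 0%N v 1 - req_len (unpair1 i))))%N (fun v => nth 0%N
      v 2)); [cpt_auto| |cpt_auto].
  apply: cpt_addn.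
    by apply: cpt_maxn; [|apply: cpt_app2 cAs _ _]; cpt_auto.
  apply: cpt_muln; first cpt_auto.
  apply: cpt_muln; first by apply: cpt_lev; cpt_auto.
  apply: cpt_expn; first cpt_auto.
  by apply: cpt_subn; [|apply: cpt_req_len]; cpt_auto.
have cfloor : cpt2 x cover_floor.
  have cD : cpt x 2 (fun v => test_prec (nth 0%N v 1)) by apply: cpt_app1 cprecc _; cpt_auto.
  apply: cpt_divn.
    by apply: cpt_maxn; [apply: cpt_app3 cC _ cD _|apply: cpt_app2 cAs cD _]; cpt_auto.
  apply: cpt_expn; first cpt_auto.
  by apply: cpt_subn => //; apply: cpt_req_len; cpt_auto.
apply: cpt_bitsn; first by apply: cpt_req_len; cpt_auto.
apply: cpt_subn; last cpt_auto.
apply: cpt_addn; last cpt_auto.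
by apply: cpt_app2 cfloor _ _; [apply: cpt_level|]; cpt_auto.
Qed.

Lemma cover_floorP c j (q := cover_floor c j) (m := cover_start R val (lev c) req_len k' j) :
  q%:R * pw R (req_len (unpair1 j)) <= m /\ m < q.+1%:R * pw R (req_len (unpair1 j)).
Proof.
have le_k' : (req_len (unpair1 j) <= test_prec j)%N by apply: req_len_le_prec; exact:
  unpair1_le.
have D0 := pw_gt0 R (test_prec j).
have <- : (cover_start_nat val (lev c) req_len k' (test_prec j) j)%:R * pw R (test_prec j) = m.
  apply: cover_start_natE => i lt_i; split; apply: req_len_le_prec; first exact: ltnW.
  by apply: leq_trans (ltnW lt_i); exact: unpair1_le.
rewrite -(pw_sub R le_k') !mulrA -!natrM ler_pM2r // ltr_pM2r // ler_nat ltr_nat.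
by rewrite leq_trunc_div ltn_ceil // expn_gt0.
Qed.

Lemma test_weight_le1 n : wsum R test_valid test_len n <= 1.
Proof.
have lev_len c j : lev c j -> (c < req_len (unpair1 j))%N.
  by have [_ levP _ _] := lv; move=> /levP[_ [t _]]; lia.
pose F d j := if lev (level d) j then pw R (req_len (unpair1 j) - d) else 0.
have F0 d j : 0 <= F d j by rewrite /F; case: ifP => // _; rewrite ltW // pw_gt0.
have row d : \sum_(0 <= j < n) F d j <= pw R d.+1.
  rewrite -(ler_pM2l (pw_gt0 R d)) -pwD.
  apply: (@le_trans _ _ (pw R (level d))); last by rewrite le_pw level_ge.
  apply: le_trans (confirmed_weight_le R (level d) n rq pfV lv).
  rewrite /wsum -big_mkcond -(big_mkord _ (fun j => pw R (k' j))) big_distrr /=.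
  apply: ler_sum => j lj; rewrite -pwD subnKC //.
  by have := lev_len _ _ lj; have := level_ge d; lia.
have -> : wsum R test_valid test_len n = \sum_(p <- [seq (unpair1 r, unpair2 r) | r <- iota 0
  n]) F p.1 p.2.
  rewrite big_map /wsum -(big_mkord test_valid (fun r => pw R (test_len r))) /index_iota subn0.
  by rewrite big_mkcond.
apply: (@le_trans _ _ (\sum_(p <- [seq (d, j) | d <- iota 0 n, j <- iota 0 n]) F p.1 p.2)).
  apply: ler_sum_subset => //.
  - rewrite map_inj_uniq ?iota_uniq // => r r' [e1 e2].
    by rewrite -(pairK r) e1 e2 pairK.
  - apply: allpairs_uniq; rewrite ?iota_uniq // => -[d j] [d' j'] _ _ //=.
  - move=> _ /mapP[r + ->]; rewrite mem_iota => /= lt_r.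
    by apply/allpairsP; exists (unpair1 r, unpair2 r); rewrite !mem_iota /=;
      split=> //; apply: leq_ltn_trans lt_r; rewrite ?unpair1_le ?unpair2_le.
rewrite big_allpairs /=.
apply: (@le_trans _ _ (\sum_(d <- iota 0 n) pw R d.+1)).
  by apply: ler_sum => d _; have := row d; rewrite /index_iota subn0.
suff -> : \sum_(d <- iota 0 n) pw R d.+1 = 1 - pw R n by have := pw_gt0 R n; lra.
elim: n {row} => [|n IHn]; first by rewrite big_nil /pw expr0 subrr.
by rewrite -addn1 iotaD big_cat big_seq1 /= IHn add0n addn1 (pwS2 R n); lra.
Qed.

End CoverRequests.

(** At level [8 * d0 + 8] some interval of the cover contains [a]; let [2 * 2^-k] be its
    length.  The prefix of [y] of length [k] is then the output of a request of the test of
    length at most [k - 4 * d0], which contradicts randomness for [d0] large. *)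
Lemma weakly_low_of_random (R : realType) (U : pfun_str) (hU : optimal U)
    (x : cantor) (V : pfun_str) (hV : optimal_in x V) :
  random_real_for V (fK R U x) -> weakly_low_for_K U V.
Proof.
move=> [y [exp_y [c0 rnd]]]; apply: contrapT => nwl.
have fin c : finite_set [set n | (K U (str_of_nat n) <= K V (str_of_nat n) + c%:Z%:E)%E].
  by apply: contrapT => inf; apply: nwl; exists c.
have [[cU0 pfU] _] := hU; have cU := computable_oracle x cU0.
have [[cV pfV] _] := hV.
have [val rq] := requests_exist cU; have le1 := requests_le1 R rq pfU.
have [vcpt _ rqE _] := rq.
have [a wa _] := wsum_sup_exists le1; have [ub lub] := wa.
have /expansion_bounds y_bounds : binary_expansion y a%:E by rewrite -(fK_wsum_sup rq wa).
have [lev lv] := confirmations_exist cV vcpt.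
have [M hM MP] := kraft_chaitin (cpt_test_valid lv) (cpt_test_len x) (cpt_test_out rq lv)
  (test_weight_le1 R rq lv pfV).
have [c2 optV] := optimal_program hV hM.
pose d0 := (c0 + c2 + 2)%N; pose c := (8 * d0 + 8)%N.
have [s0 late] := late_confirmed rq lv (fun s => optimal_total R s hV) (fin c).
have lt_s0 : wsum R val req_len s0 < a.
  have [t Ut] := optimal_total R [::] hU.
  have lt_t : (size t < (s0 + size t).+1)%N by rewrite ltnS leq_addl.
  have [i [vi ki _]] := rqE [::] t _ (or_intror erefl) Ut lt_t.
  have le_i : (s0 <= i)%N.
    have : (req_len i <= i)%N by rewrite /req_len (leq_trans (unpair1_le _)) // unpair1_le.
    by lia.
  have := wsum_mono R val req_len le_i; have := ub i.+1; have := pw_gt0 R (req_len i).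
  by rewrite wsumS vi; lra.
have [j [lj lo hi]] := cover_hits wa lt_s0 (confirmed_catches_up R lv late).
have [q_lo q_hi] := cover_floorP R val lev c j.
set k := req_len (unpair1 j) in q_lo q_hi; rewrite [(req_len \o unpair1) j]/= -/k in hi.
set q := cover_floor val lev c j in q_lo q_hi.
pose w := mkseq y k; have /andP[w_lo w_hi] := y_bounds k.
have k0 := pw_gt0 R k.
have wE : binreal R w = (val_str w)%:R * pw R k by rewrite /binreal size_mkseq.
have v_hi : (val_str w < q + 3)%N.
  rewrite -(ltr_nat R) -(ltr_pM2r k0) -wE natrD mulrDl.
  by move: q_hi; rewrite -natr1 mulrDl mul1r; lra.
have v_lo : (q <= val_str w + 1)%N.
  rewrite -(ler_nat R) -(ler_pM2r k0) natrD mulrDl mul1r -wE; lra.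
pose u := (val_str w + 1 - q)%N; pose d := (4 * d0 + u)%N.
have lt_u : (u < 4)%N by rewrite /u; lia.
have ed : (d %/ 4 = d0)%N by rewrite /d mulnC divnMDl // divn_small ?addn0.
have em : (d %% 4 = u)%N by rewrite /d mulnC modnMDl modn_small.
have [|p [Mp sp _ _]] := MP (pair d j).
  by rewrite /test_valid unpair1_pair unpair2_pair /level ed.
have out_w : str_of_nat (test_out val lev (pair d j)) = w.
  rewrite /test_out unpair1_pair unpair2_pair /level ed -/c -/k -/q em /bitsn nat_of_strK.
  have -> : (q + u - 1 = val_str w)%N by rewrite /u; lia.
  apply: val_str_inj; rewrite ?size_bits ?size_mkseq // val_bits //.
  by have := val_lt w; rewrite size_mkseq.
rewrite out_w in Mp; have [t Vt le_t] := optV _ _ Mp.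
have : ((k%:Z - c0%:Z)%:E <= (size t)%:Z%:E)%E.
  by apply: le_trans (rnd k) _; apply/K_le; exists t.
rewrite lee_fin lerBlDr -PoszD lez_nat => le_k.
have lt_k : (c < k)%N by have [_ levP _ _] := lv; have [_ [t' _]] := levP c j lj; rewrite
  -/k; lia.
move: le_t; rewrite sp /test_len unpair1_pair unpair2_pair -/k => le_t.
by move: le_k le_t lt_k lt_u; rewrite /d /c /d0; lia.
Qed.

Theorem theorem5p1 (R : realType) (U : pfun_str) (hU : optimal U)
    (x : cantor) (V : pfun_str) (hV : optimal_in x V) :
  weakly_low_for_K U V <-> random_real_for V (fK R U x).
Proof.
by split; [exact: random_of_weakly_low|exact: weakly_low_of_random].
Qed.
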